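(* For every $\epsilon_1>0$ there exists $\epsilon_0>0$ such that every solution $(g,\sigma,W)$ of the perturbation system (P) (stated in the context) with initial datum $g(0)=\mathring g\in\mathcal D$ and $\|\mathring g\|_\infty<\epsilon_0$ satisfies $$\|\sigma(t)\|_\infty< a^{-3}(t)\,\epsilon_1,\qquad t\ge 0 .$$ Moreover, if $\rho$ is the spatial density of the corresponding solution of the Vlasov-Poisson system in the original variables (see context), $\rho_0(t)=a^{-3}(t)$, and the density contrast $\delta(t,x)$ is defined by $$\rho(t,x)=\rho_0(t)\bigl(1+\delta(t,x)\bigr),$$ then $$\|\delta(t)\|_\infty<\epsilon_1,\qquad t\ge 0 .$$
   Context: Fixed background. $H\in C^1_c(\mathbb R)$ is a fixed nonnegative, compactly supported function with $\int_{\mathbb R^3}H(|v|^2)\,dv=1$. The function $a:[0,\infty)\to(0,\infty)$ is the solution of $\ddot a+\frac{4\pi}{3}a^{-2}=0$ with $a(0)=1$ and fixed $\dot a(0)>\sqrt{8\pi/3}$ (so that $\frac12\dot a^2-\frac{4\pi}{3}a^{-1}>0$); there are constants $0<c_1<c_2$ with $c_1\le\dot a(t)\le c_2$ for all $t\ge0$. The homogeneous background solution is $f_0(t,x,v)=H\bigl(a^2(t)|v-\frac{\dot a(t)}{a(t)}x|^2\bigr)$, $\rho_0(t)=a^{-3}(t)$, $U_0(t,x)=\frac{2\pi}{3}a^{-3}(t)|x|^2$; it solves the Vlasov-Poisson system $\partial_tf+v\cdot\partial_xf-\partial_xU\cdot\partial_vf=0$, $\Delta U=4\pi\rho$, $\rho(t,x)=\int_{\mathbb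 R^3} f(t,x,v)\,dv$. Function spaces. $Q=[0,1]^3$, $S=Q\times\mathbb R^3$. $C^n_\pi(Q)$ is the set of $C^n$ functions on $\mathbb R^3$ that are $\mathbb Z^3$-periodic; $C^n_\pi(S)$ is the set of $C^n$ functions $h(x,v)$ on $\mathbb R^6$ that are $\mathbb Z^3$-periodic in $x$; $C^n_{\pi,c}(S)$ is the subset of those vanishing for $|v|>u$ for some $u\ge 0$. $\|\cdot\|_p$ is the $L^p$-norm over $Q$ or $S$; $\|\cdot\|_\infty$ of a periodic function is the supremum, and $\|h\|_{1,\infty}$ is the sum of the $L^\infty$-norms of $h$ and of its first order derivatives. Perturbation system (P), for $t\ge0$, $x,v\in\mathbb R^3$: $$\partial_t g+\tfrac1a v\cdot\partial_xg-\tfrac1a(\partial_xW+\dot a\,v)\cdot\partial_vg=2aH'(a^2|v|^2)\,v\cdot\partial_xW,\quad \Delta W=4\pi a^2\sigma,\quad \sigma(t,x)=\int_{\mathbb R^3}g(t,x,v)\,dv .$$ A solution with initial datum $\mathring g$ is a function $g\in C^1([0,\infty)\times\mathbb R^6)\cap C([0,\infty);C^1_\pi(S))$ with $g(0)=\mathring g$, whose support in $v$ is bounded uniformly in $x$ and locally uniformly in $t$, satisfying (P), where $W(t)\in C^2_\pi(Q)$ is the unique periodic solution of the Poisson equation with $\int_QW(t,x)\,dx=0$. It is known that for every $\mathring g\in C^1_{\pi,c}(S)$ with $\int_S\mathring g=0$ and $\mathring g(x,v)+H(|v|^2)\ge0$ there is a unique such solution. Admissible data. For fixed constants $d_0>0$,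 $u_0>0$, $$\mathcal D=\Bigl\{\mathring g\in C^1_{\pi,c}(S):\ \int_S\mathring g=0,\ \mathring g(x,v)+H(|v|^2)\ge0\ \forall x,v\in\mathbb R^3,\ \|\mathring g\|_{1,\infty}<d_0,\ \mathring g(x,v)=0\text{ for }|v|\ge u_0\Bigr\}.$$ Corresponding solution in original variables. Given a solution $(g,\sigma,W)$ of (P), the corresponding solution of the Vlasov-Poisson system is $f(t,x,v)=f_0(t,x,v)+g\bigl(t,\,x/a(t),\,v-\frac{\dot a(t)}{a(t)}x\bigr)$, with $\rho(t,x)=\int f(t,x,v)\,dv=a^{-3}(t)+\sigma(t,x/a(t))$ and $U(t,x)=U_0(t,x)+W(t,x/a(t))$. For $\delta(t)$, $\|\cdot\|_\infty$ is the supremum over $x\in\mathbb R^3$. *)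

(* Defs.v *)
From HB Require Import structures.
From mathcomp Require Import all_boot all_order all_algebra.
From mathcomp Require Import all_classical all_reals all_analysis.

Set Implicit Arguments.
Unset Strict Implicit.
Unset Printing Implicit Defensive.

Import Order.TTheory GRing.Theory Num.Theory.
Import numFieldNormedType.Exports.

Local Open Scope classical_set_scope.
Local Open Scope ring_scope.

(* Phase space points are pairs (x, v). *)
Notation space3 R := 'rV[R]_3.
Notation phase6 R := ('rV[R]_3 * 'rV[R]_3)%type.

(* The library's own sigma-finite instance for [\x] is shadowed by the one for
   subprobabilities, hence the explicit instances on [leb2] and [leb3] below. *)
Lemma product_sigma_finite d1 d2 (T1 : measurableType d1)
    (T2 : measurableType d2) (R : realType)
    (m1 : {sigma_finite_measure set T1 -> \bar R})
    (m2 : {sigma_finite_measure set T2 -> \bar R}) :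
  sigma_finite setT (m1 \x m2)%E.
Proof.
have /sigma_finiteP[F [TF ndF Foo]] := sigma_finiteT m1.
have /sigma_finiteP[G [TG ndG Goo]] := sigma_finiteT m2.
exists (fun n => F n `*` G n).
  rewrite -setXTT TF TG predeqE => -[x y]; split.
    move=> [/= [n _ Fnx] [k _ Gky]]; exists (maxn n k) => //; split.
    - by move: x Fnx; exact/subsetPset/ndF/leq_maxl.
    - by move: y Gky; exact/subsetPset/ndG/leq_maxr.
  by move=> [n _ []/= ? ?]; split; exists n.
move=> k; have [? ?] := Foo k; have [? ?] := Goo k.
split; first exact: measurableX.
by rewrite product_measure1E// lte_mul_pinfty// ge0_fin_numE.
Qed.

Section Defs.
Variable R : realType.
Implicit Types (a H : R -> R) (t : R) (x v : space3 R) (z : phase6 R).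

(* The library norm on ['rV] is the max norm, not the Euclidean one. *)
Definition dot x v : R := \sum_(i < 3) x 0 i * v 0 i.
Definition sqnorm x : R := dot x x.
Definition enorm x : R := Num.sqrt (sqnorm x).

Definition basis_space (i : 'I_3) : space3 R := delta_mx 0 i.

Definition basis_phase (j : 'I_3 + 'I_3) : phase6 R :=
  match j with
  | inl i => (basis_space i, 0)
  | inr i => (0, basis_space i)
  end.

(* C^n through iterated partial derivatives along the family b, which is
   intended to be a basis of E *)
Fixpoint classC (I : Type) (E : normedModType R) (b : I -> E) (n : nat)
    (h : E -> R) : Prop :=
  match n with
  | 0%N => continuous h
  | m.+1 => continuous h /\ forall j : I,
      (forall e, derivable h e (b j)) /\ classC b m ('D_(b j) h)
  end.

Definition grad (w : space3 R -> R) x : space3 R :=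
  \row_i 'D_(basis_space i) w x.

Definition laplacian (w : space3 R -> R) x : R :=
  \sum_(i < 3) 'D_(basis_space i) ('D_(basis_space i) w) x.

Definition grad_x (h : phase6 R -> R) z : space3 R :=
  \row_i 'D_(basis_phase (inl i)) h z.

Definition grad_v (h : phase6 R -> R) z : space3 R :=
  \row_i 'D_(basis_phase (inr i)) h z.

(* Time derivative of the restriction of f to [0, +oo[: two-sided for t > 0,
   one-sided at t = 0.  Values of f at negative times are never used. *)
Definition time_quotient (f : R -> R) t (h : R) : R := h^-1 * (f (t + h) - f t).
Definition time_incr t : set_system R := within [set h | 0 <= t + h] 0^'.
Definition time_derivable (f : R -> R) t : Prop :=
  cvg (time_quotient f t @ time_incr t).
Definition time_derive (f : R -> R) t : R :=
  lim (time_quotient f t @ time_incr t).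

Definition jointly_continuous (g : R -> phase6 R -> R) : Prop :=
  {within [set q : R * phase6 R | 0 <= q.1],
     continuous (fun q : R * phase6 R => g q.1 q.2)}.

Definition C1_time_phase (g : R -> phase6 R -> R) : Prop :=
  [/\ jointly_continuous g,
      forall t z, 0 <= t -> time_derivable (g ^~ z) t,
      jointly_continuous (fun t z => time_derive (g ^~ z) t) &
      forall j,
        (forall t z, 0 <= t -> derivable (g t) z (basis_phase j)) /\
        jointly_continuous (fun t z => 'D_(basis_phase j) (g t) z)].

Definition sup_norm (T : Type) (h : T -> R) : \bar R :=
  ereal_sup (range (fun e => `|h e|%:E)).

Definition norm1oo (h : phase6 R -> R) : \bar R :=
  (sup_norm h + \sum_(j : 'I_3 + 'I_3) sup_norm ('D_(basis_phase j) h))%E.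

(* Lebesgue measure on R^3 lives on the type [R * R * R], which is identified
   with ['rV_3] through [vec3]. *)
Definition vec3 (p : R * R * R) : space3 R :=
  \row_(i < 3) [:: p.1.1; p.1.2; p.2]`_i.

Definition leb2 := (@lebesgue_measure R \x @lebesgue_measure R)%E.
HB.instance Definition _ := Measure.on leb2.
HB.instance Definition _ :=
  Measure_isSigmaFinite.Build _ _ _ leb2 (product_sigma_finite _ _).

Definition leb3 := (leb2 \x @lebesgue_measure R)%E.
HB.instance Definition _ := Measure.on leb3.
HB.instance Definition _ :=
  Measure_isSigmaFinite.Build _ _ _ leb3 (product_sigma_finite _ _).

Definition integral3 (D : set (space3 R)) (h : space3 R -> R) : R :=
  Rintegral leb3 (vec3 @^-1` D) (h \o vec3).

Definition integral6 (D : set (phase6 R)) (h : phase6 R -> R) : R :=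
  let vec33 p := (vec3 p.1, vec3 p.2) in
  Rintegral (leb3 \x leb3)%E (vec33 @^-1` D) (h \o vec33).

Definition unit_cube : set (space3 R) := [set x | forall i, 0 <= x 0 i <= 1].
Definition unit_phase : set (phase6 R) := unit_cube `*` setT.

Definition lattice_vec (k : 'rV[int]_3) : space3 R := map_mx intr k.

Definition Cper_space (n : nat) (w : space3 R -> R) : Prop :=
  classC basis_space n w /\ forall k x, w (x + lattice_vec k) = w x.

Definition Cper_phase (n : nat) (h : phase6 R -> R) : Prop :=
  classC basis_phase n h /\ forall k x v, h (x + lattice_vec k, v) = h (x, v).

Definition Cper_phase_c (n : nat) (h : phase6 R -> R) : Prop :=
  Cper_phase n h /\
  exists2 u : R, 0 <= u & forall x v, u < enorm v -> h (x, v) = 0.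

Definition admissible_profile H : Prop :=
  [/\ (forall s : R, derivable H s 1) /\ continuous (derive1 H),
      compact (closure [set s | H s != 0]),
      forall s, 0 <= H s &
      integral3 setT (fun v => H (sqnorm v)) = 1].

Definition scale_factor a : Prop :=
  [/\ forall t, 0 <= t -> 0 < a t,
      forall t, 0 <= t ->
        time_derivable a t /\ time_derivable (time_derive a) t,
      forall t, 0 <= t ->
        time_derive (time_derive a) t + 4 * pi / 3 * (a t) ^- 2 = 0,
      a 0 = 1 &
      Num.sqrt (8 * pi / 3) < time_derive a 0].

Definition f_bg a H t z : R :=
  H (a t ^+ 2 * sqnorm (z.2 - (time_derive a t / a t) *: z.1)).

Definition rho_bg a t : R := a t ^- 3.

Definition admissible_data H (d0 u0 : R) (g0 : phase6 R -> R) : Prop :=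
  [/\ Cper_phase_c 1 g0,
      integral6 unit_phase g0 = 0,
      forall x v, 0 <= g0 (x, v) + H (sqnorm v),
      (norm1oo g0 < d0%:E)%E &
      forall x v, u0 <= enorm v -> g0 (x, v) = 0].

Definition vlasov_eq a H (g : R -> phase6 R -> R) (W : R -> space3 R -> R)
    t x v : Prop :=
  time_derive (fun s => g s (x, v)) t
  + (a t)^-1 * dot v (grad_x (g t) (x, v))
  - (a t)^-1 * dot (grad (W t) x + time_derive a t *: v) (grad_v (g t) (x, v))
  = 2 * a t * derive1 H (a t ^+ 2 * sqnorm v) * dot v (grad (W t) x).

Record perturbation_solution a H (g0 : phase6 R -> R) (g : R -> phase6 R -> R)
    (sigma W : R -> space3 R -> R) : Prop := {
  sol_C1 : C1_time_phase g;
  sol_Cper : forall t, 0 <= t -> Cper_phase 1 (g t);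
  sol_continuous_C1per : forall t, 0 <= t ->
    norm1oo (fun z => g s z - g t z) @[s --> within [set s | 0 <= s] (nbhs t)]
      --> 0%E;
  sol_init : g 0 = g0;
  sol_support : forall T : R, 0 <= T -> exists u : R,
    forall t x v, 0 <= t <= T -> u < enorm v -> g t (x, v) = 0;
  sol_density : forall t x, 0 <= t ->
    sigma t x = integral3 setT (fun v => g t (x, v));
  sol_potential : forall t, 0 <= t -> Cper_space 2 (W t);
  sol_poisson : forall t x, 0 <= t ->
    laplacian (W t) x = 4 * pi * a t ^+ 2 * sigma t x;
  sol_mean0 : forall t, 0 <= t -> integral3 unit_cube (W t) = 0;
  sol_vlasov : forall t x v, 0 <= t -> vlasov_eq a H g W t x v
}.

Definition vp_f a H (g : R -> phase6 R -> R) t z : R :=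
  f_bg a H t z
  + g t ((a t)^-1 *: z.1, z.2 - (time_derive a t / a t) *: z.1).

Definition vp_rho a H (g : R -> phase6 R -> R) t x : R :=
  integral3 setT (fun v => vp_f a H g t (x, v)).

End Defs.

(* Main.v *)
Require Import Defs.
From mathcomp Require Import all_boot all_order all_algebra.
From mathcomp Require Import all_classical all_reals all_analysis.
From mathcomp Require Import measurable_realfun ring lra.
Set Implicit Arguments.
Unset Strict Implicit.
Unset Printing Implicit Defensive.
Import Order.TTheory GRing.Theory Num.Theory.
Import numFieldNormedType.Exports.
Local Open Scope classical_set_scope.
Local Open Scope ring_scope.

(* With the momentum w = a v, the density f = H(|w|^2) + g is constant along
   x' = w / a^2, w' = - grad W, and a >= 1 + c t.  Suppose
   a^3 |sigma| <= S on [0, t] with S small.  Then Delta W = O(S / a), hence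
   grad W is bounded and Hoelder-1/2 with constant O(S / a).  Two
   characteristics ending at the same (t, x) were at distance O(1 / a(s)) at
   time s, so the forces acting on them differ by O(S a^(-3/2)), which is
   integrable in time.  The momentum shift w(0) - w is therefore, up to a
   small error, a constant c independent of w, and f(t, x, w) is close to
   H(|w + c|^2), whose integral is the background density.  This gives
   a^3 |sigma(t)| <= C (eps + int_0^t a^(-3/2) S), and choosing for S the
   corresponding Gronwall exponential closes the bootstrap.

   No flow is needed: Euler polygons along which f is constant up to o(1)
   replace the characteristics.  No Green function is needed either: for
   periodic W the maximum principle applied to W(x + z e) - W(x - z e) bounds
   the gradient, and applied once more to the differences
   W(. + y e') - W(. - y e') it gives the Hoelder bound by interpolation. *)

(** * Compactness and norms *)

(** The force bound O(S / a) is not integrable in time, so the momentum shift of a single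
    characteristic has no bound uniform in [t]. Hence [f(t, x, .)] is compared with a translate of
    the background profile and not with the profile itself; a translation leaves the integral
    unchanged. The shift is read off at a momentum [w1] whose polygon ends in the unit ball: around
    [w1] a box of radius independent of [t] catches everything, since outside it the translate and,
    up to the polygon error, [f] both vanish. The existence of [w1] and this localisation rest on
    [gam * S t <= 2^-1]: two momenta at distance r >= 1 have shifts that differ by at most r / 2.
    Distances below 1 are excluded because Hoelder exponent 1/2 yields sqrt r, which is at most r
    only for r >= 1. The bootstrap must return strictly less than it assumes. The constant [C] in
    the exponent of the weight is taken large, so that the accumulated force differences cost a
    quarter of the weight, and the data cost half of it; the factor 3/4 leaves room for continuity
    in time. The exponent is bounded because (1 + c s)^(-3/2) is integrable, so a small [M] keeps
    the weight small for ever. *)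

Lemma within_continuous_norm (R : realType) (T : normedModType R) (A : set T)
    (f : T -> R) :
  {within A, continuous f} <->
  (forall t, A t -> forall e, 0 < e -> exists2 d, 0 < d &
    forall s, A s -> `|s - t| < d -> `|f s - f t| < e).
Proof.
split => [/subspace_continuousP fc t At e e0|H].
  have /cvgrPdist_lt/(_ e e0) := fc t At.
  rewrite near_withinE => /nbhs_normP[d /= d0 Hd]; exists d => // s As sd.
  by rewrite distrC; apply: Hd => //=; rewrite distrC.
apply/subspace_continuousP => t At; apply/cvgrPdist_lt => e e0.
rewrite near_withinE; have [d d0 Hd] := H t At e e0.
by apply/nbhs_normP; exists d => //= s sd As; rewrite distrC; apply: Hd => //;
  rewrite distrC.
Qed.

(** Heine-Cantor. Continuity is relative to a larger set [A] because the solution is only continuous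
    on the half space of nonnegative times, in which the boxes [K] lie. *)
Lemma uniformly_continuous_on_compact (R : realType) (T : normedModType R)
    (A K : set T) (f : T -> R) :
  compact K -> K `<=` A -> {within A, continuous f} ->
  forall e, 0 < e -> exists2 d, 0 < d &
    forall p q, K p -> K q -> `|q - p| < d -> `|f q - f p| < e.
Proof.
move=> cK KA /within_continuous_norm fc e e0.
pose P (d : R) (p : T) :=
  K p -> forall q, K q -> `|q - p| < d -> `|f q - f p| < e.
have : \forall d \near 0^'+, K `<=` P d.
  move/compact_near_coveringP: cK; apply => x Kx.
  have [d d0 hd] := fc x (KA x Kx) (e / 2) (divr_gt0 e0 (ltr0Sn _ 1)).
  have dh : 0 < d / 2 by rewrite divr_gt0.
  exists ([set p | `|p - x| < d / 2], [set r | r < d / 2]) => /=.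
    split; last exact: nbhs_right_lt.
    by apply/nbhs_normP; exists (d / 2) => // y /=; rewrite distrC.
  move=> [p r] /= [px rd] Kp q Kq qp.
  have qx : `|q - x| < d by apply: le_lt_trans (ler_distD p q x) _; lra.
  have h1 := hd q (KA q Kq) qx.
  have h2 : `|f p - f x| < e / 2 by apply: hd; [exact: KA|lra].
  by apply: le_lt_trans (ler_distD (f x) _ _) _; rewrite (distrC (f x)); lra.
rewrite /at_right near_withinE => /nbhs_normP[r /= r0 hr].
have rd : `|0 - r / 2| < r by rewrite sub0r normrN gtr0_norm ?divr_gt0//; lra.
exists (r / 2) => [|p q Kp Kq]; first by rewrite divr_gt0.
by apply: (hr (r / 2)) => //=; rewrite divr_gt0.
Qed.

Lemma compact_box (R : realType) n (r : R) :
  compact [set v : 'rV[R]_n | `|v| <= r].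
Proof.
apply: bounded_closed_compact.
  by exists r; split; [exact: num_real|move=> x rx v /= /le_trans; apply;
    exact: ltW].
apply: (@closed_comp _ _ (fun v : 'rV[R]_n => `|v|) [set x | x <= r]);
  last exact: closed_le.
by move=> v _; exact: norm_continuous.
Qed.

Lemma bounded_on_compact (R : realType) (T : normedModType R)
    (A K : set T) (f : T -> R) :
  compact K -> K `<=` A -> {within A, continuous f} ->
  exists2 M, 0 <= M & forall p, K p -> `|f p| <= M.
Proof.
move=> cK KA fc.
have [->|/set0P K0] := eqVneq K set0; first by exists 0.
have fK : {within K, continuous (fun p => `|f p|)}.
  apply/within_continuous_norm => t Kt e e0.
  move/within_continuous_norm: fc => /(_ t (KA t Kt) e e0)[d d0 hd].
  exists d => // s Ks sd; apply: le_lt_trans (hd s (KA s Ks) sd).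
  exact: ler_dist_dist.
have [c _ cmax] := compact_EVT_max K0 cK fK.
by exists `|f c| => // p Kp; apply: cmax; rewrite inE.
Qed.

Lemma norm_pair_lt (R : realType) (T U : normedModType R) (p : T * U) (d : R) :
  `|p.1| < d -> `|p.2| < d -> `|p| < d.
Proof. by move=> h1 h2; rewrite prod_normE gt_max h1. Qed.

Lemma norm_pair_le (R : realType) (T U : normedModType R) (p : T * U) (d : R) :
  `|p.1| <= d -> `|p.2| <= d -> `|p| <= d.
Proof. by move=> h1 h2; rewrite prod_normE ge_max h1. Qed.

Lemma norm_row_le (R : realType) n (x : 'rV[R]_n) (r : R) : 0 <= r ->
  (`|x| <= r) = [forall i, `|x 0 i| <= r].
Proof.
move=> r0; rewrite [X in X <= _]/Num.norm/= mx_normrE.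
apply/idP/forallP => [xr i|xr].
  by apply: le_trans xr; apply/bigmax_geP; right => /=; exists (0, i).
by apply/bigmax_leP; split => // -[i j] _ /=; rewrite (ord1 i).
Qed.

Lemma row_le_norm (R : realType) n (x : 'rV[R]_n) i : `|x 0 i| <= `|x|.
Proof. by move: (lexx `|x|); rewrite norm_row_le// => /forallP. Qed.

(** * Lebesgue integration on R^3 *)

(** Rounding [y] down to the grid of mesh 1/(n+1) turns [f] into a function that is a measurable
    section on each of countably many strips; continuity in [y] recovers [f] as the pointwise limit.
    Iterated, this makes continuous functions measurable for the product sigma-algebra on
    [R * R * R]. *)
Lemma measurable_caratheodory d (T : measurableType d) (R : realType)
    (f : T * measurableTypeR R -> R) :
  (forall y, measurable_fun setT (fun p => f (p, y))) ->
  (forall p, continuous (fun y : R => f (p, y))) ->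
  measurable_fun setT f.
Proof.
move=> fm fc.
pose r (n : nat) (y : R) : R := (Num.floor (y * n.+1%:R))%:~R / n.+1%:R.
pose F n (q : T * measurableTypeR R) := f (q.1, r n q.2).
apply: (@measurable_fun_cvg _ _ _ _ F) => //.
- move=> n _ A mA; rewrite setTI.
  have -> : F n @^-1` A = \bigcup_(k in @setT int)
      ((fun p => f (p, k%:~R / n.+1%:R)) @^-1` A `*`
       [set y : R | Num.floor (y * n.+1%:R) = k]).
    apply/seteqP; split => [[p y] /= Ay|[p y] /= [k _ [/= Ak ky]]].
      by exists (Num.floor (y * n.+1%:R)).
    by rewrite /F /r /= ky.
  apply: countable_bigcupT_measurable => // k; apply: measurableX.
    by rewrite -[X in measurable X]setTI; apply: fm.
  have -> : [set y : R | Num.floor (y * n.+1%:R) = k] =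
      `[k%:~R / n.+1%:R, (k + 1)%:~R / n.+1%:R[%classic.
    apply/seteqP; split => y /=; rewrite in_itv/= ler_pdivrMr ?ltr_pdivlMr //.
      by move=> <-; exact: floor_itv.
    by move/floor_def.
  exact: measurable_itv.
- move=> [p y] _; rewrite /F /=.
  apply: (@cvg_comp _ _ _ (fun n => r n y) (fun z : R => f (p, z)) _ (nbhs y));
    last exact: fc.
  apply/cvgrPdist_le => e e0; near=> n.
  have n0 : 0 < n.+1%:R :> R by [].
  have h1 : r n y <= y by rewrite /r ler_pdivrMr //; exact: floor_le.
  rewrite ger0_norm ?subr_ge0//.
  have h3 : y < r n y + n.+1%:R^-1.
    rewrite /r -(ltr_pM2r n0) mulrDl mulVf ?gt_eqF// mulfVK ?gt_eqF//.
    have := floorD1_gt (y * n.+1%:R); by rewrite intrD.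
  apply: le_trans (_ : n.+1%:R^-1 <= e); first by rewrite lerBlDl ltW.
  by apply: ltW; near: n; exact: (near_infty_natSinv_lt (PosNum e0)).
Unshelve. all: by end_near. Qed.

Lemma cvg_row (R : realType) n (T : Type) (F : set_system T) (FF : Filter F)
    (f : T -> 'rV[R]_n) (l : 'rV[R]_n) :
  (forall i, f x 0 i @[x --> F] --> l 0 i) -> f @ F --> l.
Proof.
move=> fl; apply/cvg_ballP => e e0.
have : \forall x \near F, forall i, ball (l 0 i) e (f x 0 i).
  by apply: filter_forall => i; move/cvg_ballP: (fl i); exact.
apply: filterS => x fx; split => // i j; rewrite (ord1 i); exact: fx.
Qed.

Lemma continuous_vec3 (R : realType) :
  continuous (@vec3 R : R * R * R -> 'rV[R]_3).
Proof.
move=> p; apply: cvg_row => i.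
under eq_cvg do rewrite mxE.
rewrite mxE.
have c1 : (x.1.1 @[x --> p]) --> p.1.1.
  by apply: (@continuous_comp _ _ _ (@fst (R * R) R) (@fst R R) p);
    exact: cvg_fst.
have c2 : (x.1.2 @[x --> p]) --> p.1.2.
  by apply: (@continuous_comp _ _ _ (@fst (R * R) R) (@snd R R) p);
    [exact: cvg_fst|exact: cvg_snd].
have c3 : (x.2 @[x --> p]) --> p.2 by exact: cvg_snd.
by case: i => [[|[|[|//]]] ?].
Qed.

Lemma measurable_vec3 (R : realType) (h : 'rV[R]_3 -> R) :
  continuous h -> measurable_fun setT (h \o @vec3 R).
Proof.
move=> hc.
have hv : continuous (h \o @vec3 R : R * R * R -> R).
  by move=> p; apply: continuous_comp; [exact: continuous_vec3|exact: hc].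
have cpair (T U : topologicalType) (a : T) (b : U) :
    continuous (fun y : U => (a, y)) /\ continuous (fun x : T => (x, b)).
  by split => z; [exact: (cvg_pair (cvg_cst _) cvg_id)|exact: (cvg_pair cvg_id
    (cvg_cst _))].
apply: (@measurable_caratheodory _ _ R (h \o @vec3 R)).
- move=> y; apply: (@measurable_caratheodory _ _ R (fun p => h (vec3 (p, y)))).
  + move=> y'; apply: continuous_measurable_fun => x.
    apply: (@continuous_comp _ _ _ (fun x => ((x, y'), y)) (h \o @vec3 R));
      last exact: hv.
    exact: (cvg_pair ((cpair R R 0 y').2 x) (cvg_cst _)).
  + move=> p x.
    apply: (@continuous_comp _ _ _ (fun x => ((p, x), y)) (h \o @vec3 R));
      last exact: hv.
    exact: (cvg_pair ((cpair R R p 0).1 x) (cvg_cst _)).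
- move=> p x; apply: (@continuous_comp _ _ _ (fun x => (p, x)) (h \o @vec3 R));
    last exact: hv.
  exact: (cpair _ R p 0).1.
Qed.

(** The image of [m] under [phi] is [k] times [m]. The formulation through integrals of nonnegative
    functions lets Tonelli carry it from the axes to products. *)
Definition scales_integral d (T : measurableType d) (R : realType)
    (m : set T -> \bar R) (phi : T -> T) (k : R) : Prop :=
  measurable_fun setT phi /\
  forall f : T -> \bar R, measurable_fun setT f -> (forall x, 0 <= f x)%E ->
    (\int[m]_x f (phi x) = k%:E * \int[m]_x f x)%E.

Lemma scales_integral_prod d1 d2 (T1 : measurableType d1)
    (T2 : measurableType d2) (R : realType)
    (m1 : {sigma_finite_measure set T1 -> \bar R})
    (m2 : {sigma_finite_measure set T2 -> \bar R}) phi1 phi2 (k1 k2 : R) :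
  0 <= k1 -> 0 <= k2 ->
  scales_integral m1 phi1 k1 -> scales_integral m2 phi2 k2 ->
  scales_integral (m1 \x m2)%E (fun p => (phi1 p.1, phi2 p.2)) (k1 * k2).
Proof.
move=> k10 k20 [mphi1 i1] [mphi2 i2].
have mphi : measurable_fun setT (fun p : T1 * T2 => (phi1 p.1, phi2 p.2)).
  by apply: measurable_fun_pair;
    [exact: measurableT_comp mphi1 measurable_fst|exact: measurableT_comp mphi2
      measurable_snd].
split => // f mf f0.
rewrite (fubini_tonelli1 (fun p => f (phi1 p.1, phi2 p.2)))//; last first.
  exact: measurableT_comp mphi.
rewrite (fubini_tonelli1 f mf f0) /fubini_F /=.
have mF := measurable_fun_fubini_tonelli_F (m2 := m2) f mf f0.
have F0 x : (0 <= fubini_F m2 f x)%E by apply: integral_ge0 => y _.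
under eq_integral.
  move=> x _; rewrite (i2 (fun y => f (phi1 x, y)))//; last first.
    by have := measurable_fun_pair2 (phi1 x) mf.
  over.
have mG := measurableT_comp mF mphi1.
rewrite ge0_integralZl//=; last by move=> x _; exact: integral_ge0.
by have -> := i1 _ mF F0; rewrite EFinM muleCA muleA.
Qed.

(** The image of Lebesgue measure under [phi], multiplied by [c], gives every half-open interval its
    length, hence is Lebesgue measure by uniqueness. *)
Lemma scales_integral_lebesgue (R : realType) (c b : R) : 0 < c ->
  scales_integral (@lebesgue_measure R) (fun x => c * x + b) c^-1.
Proof.
move=> c0; set phi : measurableTypeR R -> measurableTypeR R := fun x => _.
have mphi : measurable_fun setT phi.
  by apply: measurable_funD => //; apply: measurable_funM.
split=> // f mf f0.
pose mu0 : {measure set _ -> \bar R} := mscale (NngNum (ltW c0)) (pushforward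
  (@lebesgue_measure R) phi).
pose mu := mu0 mphi.
have muE : forall A : set (measurableTypeR R),
  measurable A -> lebesgue_measure A = mu A.
  apply: (@lebesgue_measure_unique R mu) => X /ocitvP[->|[[x y] /= xy ->]].
    by rewrite !measure0.
  rewrite /mu /mscale /= /pushforward.
  have -> : phi @^-1` `]x, y]%classic = `](x - b) / c, (y - b) / c]%classic.
    apply/seteqP; split => z /=; rewrite !in_itv/= /phi ltr_pdivrMr//
      ler_pdivlMr//.
      by move=> /andP[? ?]; apply/andP; split; lra.
    by move=> /andP[? ?]; apply/andP; split; lra.
  rewrite !lebesgue_measure_itv /= !lte_fin xy ltr_pM2r ?invr_gt0// ltrD2r xy.
  rewrite -!EFinB -EFinM; congr EFin.
  by field; rewrite ?gt_eqF.
transitivity (\int[pushforward (@lebesgue_measure R) phi]_x f x)%E.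
  by rewrite ge0_integral_pushforward.
rewrite [in RHS](eq_measure_integral mu); last by move=> A mA _; exact: muE.
rewrite ge0_integral_mscale//= muleA -EFinM mulVf ?gt_eqF// mul1e //.
Qed.

Lemma box_itv (R : realType) (w : 'rV[R]_3) (r : R) : 0 <= r ->
  @vec3 R @^-1` [set v | `|v - w| <= r] =
  (`[w 0 0 - r, w 0 0 + r] `*` `[w 0 1 - r, w 0 1 + r]) `*`
    `[w 0 2%:R - r, w 0 2%:R + r].
Proof.
move=> r0; apply/seteqP; split => -[[x y] z] /=;
  rewrite norm_row_le// !in_itv/=.
  move=> /forallP h.
  by move: (h 0) (h 1) (h 2%:R); rewrite !mxE/= !ler_distl.
move=> [[hx hy] hz]; apply/forallP => -[[|[|[|//]]] i].
- by rewrite (_ : Ordinal i = 0) ?mxE/= ?ler_distl//; exact/val_inj.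
- by rewrite (_ : Ordinal i = 1) ?mxE/= ?ler_distl//; exact/val_inj.
- by rewrite (_ : Ordinal i = 2%:R) ?mxE/= ?ler_distl//; exact/val_inj.
Qed.

Lemma measurable_box (R : realType) (w : 'rV[R]_3) (r : R) : 0 <= r ->
  measurable (@vec3 R @^-1` [set v | `|v - w| <= r] :
    set (measurableTypeR R * measurableTypeR R * measurableTypeR R)).
Proof.
by move=> r0; rewrite box_itv//; do 2 apply: measurableX => //.
Qed.

Lemma leb3_box (R : realType) (w : 'rV[R]_3) (r : R) : 0 <= r ->
  leb3 (@vec3 R @^-1` [set v | `|v - w| <= r]) = ((2 * r) ^+ 3)%:E.
Proof.
move=> r0; rewrite box_itv//.
have I (c : R) : @lebesgue_measure R `[c - r, c + r]%classic = (2 * r)%:E.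
  rewrite lebesgue_measure_itv/= lte_fin.
  case: ifPn => [_|]; first by rewrite -EFinB; congr EFin; ring.
  rewrite -leNgt => h; congr EFin; lra.
have -> : ((2 * r) ^+ 3)%:E = ((2 * r)%:E * (2 * r)%:E * (2 * r)%:E)%E.
  by rewrite -!EFinM; congr EFin; ring.
rewrite -{1}(I (w 0 0)) -{1}(I (w 0 1)) -(I (w 0 2%:R)).
have E2 := @product_measure1E _ _ _ _ _ (@lebesgue_measure R)
  (@lebesgue_measure R).
have E3 := @product_measure1E _ _ _ _ _ (@leb2 R) (@lebesgue_measure R).
by rewrite -E2// -E3//; apply: measurableX.
Qed.

Lemma integrable_box (R : realType) (w : 'rV[R]_3) (r k : R) : 0 <= r ->
  (@leb3 R).-integrable setT
    (EFin \o (fun p => k * \1_(@vec3 R @^-1` [set v | `|v - w| <= r]) p)).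
Proof.
move=> r0; have mB := measurable_box w r0.
pose B := @vec3 R @^-1` [set v | `|v - w| <= r].
suff iB : (@leb3 R).-integrable setT (EFin \o \1_B).
  move: (integrableZl measurableT k iB); exact: eq_integrable.
apply/integrableP; split; first exact/measurable_EFinP/measurable_indic.
under eq_integral do rewrite gee0_abs ?lee_fin//.
rewrite integral_indic// setIT [X in (X < _)%E](_ : _
  = ((2 * r) ^+ 3)%:E) ?ltry//.
exact: leb3_box.
Qed.

Lemma Rintegral_box (R : realType) (w : 'rV[R]_3) (r k : R) : 0 <= r ->
  Rintegral (@leb3 R) setT
    (fun p => k * \1_(@vec3 R @^-1` [set v | `|v - w| <= r]) p) =
  k * (2 * r) ^+ 3.
Proof.
move=> r0; have mB := measurable_box w r0.
rewrite RintegralZl//; last first.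
  have := integrable_box w 1 r0.
  by apply: eq_integrable => // p _ /=; rewrite mul1r.
congr (_ * _); rewrite /Rintegral integral_indic// setIT.
by rewrite [X in fine X](_ : _ = ((2 * r) ^+ 3)%:E)//; exact: leb3_box.
Qed.

Lemma integrable_continuous (R : realType) (h : 'rV[R]_3 -> R) (u : R) :
  continuous h -> (forall v, u < `|v| -> h v = 0) ->
  (@leb3 R).-integrable setT (EFin \o (h \o @vec3 R)).
Proof.
move=> hc hu.
have [M M0 hM] : exists2 M, 0 <= M & forall v, `|h v| <= M.
  have [M M0 hM] := bounded_on_compact (@compact_box R 3 `|u|) (@subsetT _ _)
    (continuous_subspaceT hc).
  exists M => // v; have [vu|vu] := leP `|v| `|u|; first exact: hM.
  by rewrite hu ?normr0// (le_lt_trans (ler_norm _)).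
have mh := measurable_vec3 hc.
move: (integrable_box 0 M (normr_ge0 u)); apply: le_integrable => //.
  by apply/measurable_EFinP.
move=> p _; rewrite /= lee_fin indicE.
case: (boolP (_ \in _)); first by rewrite mulr1 (ger0_norm M0).
rewrite notin_setE /= subr0 => /negP; rewrite -ltNge => up.
by rewrite hu ?normr0// (le_lt_trans (ler_norm _)).
Qed.

(** Two boxes serve the later estimate: one of fixed radius carries the true error, the other grows
    with time but has a weight that can be made arbitrarily small. *)
Lemma le_integral3_box (R : realType) (h : 'rV[R]_3 -> R) (u : R)
    (w1 w2 : 'rV[R]_3) (r1 r2 k1 k2 : R) :
  continuous h -> (forall v, u < `|v| -> h v = 0) ->
  0 <= r1 -> 0 <= r2 ->
  (forall v, `|h v| <=
    k1 * (`|v - w1| <= r1)%R%:R + k2 * (`|v - w2| <= r2)%R%:R) ->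
  `|integral3 setT h| <= k1 * (2 * r1) ^+ 3 + k2 * (2 * r2) ^+ 3.
Proof.
move=> hc hu r10 r20 hle.
have ih := integrable_continuous hc hu.
apply: le_trans (le_normr_Rintegral _ ih) _ => //.
rewrite -(Rintegral_box w1 k1 r10) -(Rintegral_box w2 k2 r20) -RintegralD//;
  [|exact: integrable_box|exact: integrable_box].
apply: le_Rintegral => //.
- have := integrable_abse ih.
  by apply: eq_integrable.
- move: (integrableD measurableT (integrable_box w1 k1 r10) (integrable_box w2
    k2 r20)).
  exact: eq_integrable.
move=> p _ /=; apply: le_trans (hle _) _.
have E w r : (p \in @vec3 R @^-1` [set v | `|v - w| <= r]) = (`|vec3 p - w|
  <= r).
  by apply/idP/idP; rewrite inE.
by rewrite !indicE !E.
Qed.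

Lemma integral3D (R : realType) (h1 h2 : 'rV[R]_3 -> R) (u1 u2 : R) :
  continuous h1 -> (forall v, u1 < `|v| -> h1 v = 0) ->
  continuous h2 -> (forall v, u2 < `|v| -> h2 v = 0) ->
  integral3 setT (fun v => h1 v + h2 v) = integral3 setT h1 + integral3 setT h2.
Proof.
move=> c1 s1 c2 s2.
exact: (RintegralD measurableT (integrable_continuous c1 s1)
  (integrable_continuous c2 s2)).
Qed.

Lemma integral3_affine (R : realType) (h : 'rV[R]_3 -> R) (u c : R)
    (b : 'rV[R]_3) :
  0 < c -> continuous h -> (forall v, u < `|v| -> h v = 0) ->
  integral3 setT (fun v => h (c *: v + b)) = c ^- 3 * integral3 setT h.
Proof.
move=> c0 hc hu.
have ih := integrable_continuous hc hu.
pose phi (i : 'I_3) : measurableTypeR R -> measurableTypeR R := fun x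
  => c * x + b 0 i.
pose Phi := fun p : R * R * R => ((phi 0 p.1.1, phi 1 p.1.2), phi 2%:R p.2).
have [mP sP] : scales_integral (@leb3 R) Phi (c ^- 3).
  have -> : c ^- 3 = c^-1 * c^-1 * c^-1 by rewrite -!invfM; congr (_^-1); ring.
  have ci : 0 <= c^-1 by rewrite invr_ge0 ltW.
  apply: (scales_integral_prod (phi1 := fun p : R * R => (phi 0 p.1,
    phi 1 p.2)) (phi2 := phi 2%:R) (m1 := @leb2 R)) => //.
  - exact: mulr_ge0.
  - by apply: scales_integral_prod => //; exact: scales_integral_lebesgue.
  - exact: scales_integral_lebesgue.
have PhiE p : vec3 (Phi p) = c *: vec3 p + b.
  apply/rowP => -[[|[|[|//]]] i]; rewrite !mxE/= /phi; congr (_ + b 0 _);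
    exact/val_inj.
rewrite /integral3 /Rintegral /=.
under eq_integral do rewrite -PhiE.
pose F := EFin \o (h \o @vec3 R).
have mF : measurable_fun setT F by case/integrableP : ih.
rewrite -[X in fine X = _]/(\int[@leb3 R]_x ((F \o Phi) x))%E.
rewrite -[X in _ * fine X]/(\int[@leb3 R]_x (F x))%E.
(* [scales_integral] speaks of nonnegative functions, so it is applied to the positive and the
   negative part; both integrals are finite by integrability. *)
rewrite [X in fine X = _]integralE [X in _ * fine X]integralE.
have -> : (\int[@leb3 R]_x ((F \o Phi)^\+%E x)
  = (c ^- 3)%:E * \int[@leb3 R]_x (F^\+%E x))%E.
  have := (sP (F^\+)%E (measurable_funepos mF) (fun p => funepos_ge0 F p))
    => E; apply: (etrans _ E).
  by apply: eq_integral => p _; rewrite ?funeposE ?funenegE.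
have -> : (\int[@leb3 R]_x ((F \o Phi)^\-%E x)
  = (c ^- 3)%:E * \int[@leb3 R]_x (F^\-%E x))%E.
  have := (sP (F^\-)%E (measurable_funeneg mF) (fun p => funeneg_ge0 F p))
    => E; apply: (etrans _ E).
  by apply: eq_integral => p _; rewrite ?funeposE ?funenegE.
have fp := integrable_pos_fin_num measurableT ih.
have fn := integrable_neg_fin_num measurableT ih.
move: fp fn; rewrite -/F.
case: (\int[@leb3 R]_x (F^\+ x))%E => // A _; case: (\int[@leb3 R]_x (F^\-
  x))%E => // B _.
by rewrite -!EFinM -!EFinB /= mulrBr.
Qed.

(** * One-sided time derivatives and the scale factor *)

Section time_derivative.
Variable R : realType.
Implicit Types (f : R -> R) (s t : R).

Lemma time_derivable_cvg f t : 0 <= t -> time_derivable f t ->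
  time_quotient f t @ time_incr t --> time_derive f t.
Proof. by []. Qed.

(** For [t > 0] the constraint [0 <= t + h] holds for all small [h], so the one-sided filter is the
    punctured neighbourhood filter. *)
Lemma time_derivable_is_derive f t : 0 < t -> time_derivable f t ->
  is_derive t 1 f (time_derive f t).
Proof.
move=> t0 ft.
have E : time_incr t = 0^'.
  apply/seteqP; split => A.
    rewrite /time_incr /within /= => HA.
    near=> h; apply: (near HA h) => //.
    near: h; apply: nbhs_dnbhs; exists t => //= h;
      rewrite /= sub0r normrN => ht.
    by have := ler_norm (- h); rewrite normrN; lra.
  by move=> HA; apply: filterS HA => h Ah _.
have q : (fun h => h^-1 *: ((f \o shift t) (h *: 1) - f t)) = time_quotient f t.
  by apply/funext => h; rewrite /time_quotient /= /shift/= [h *: 1]mulr1 (addrC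
    h t).
split; first by rewrite /derivable q -E; exact: ft.
rewrite /derive q /time_derive E //.
Unshelve. all: by end_near. Qed.

Lemma time_derivable_cont f t : 0 <= t -> time_derivable f t ->
  forall e, 0 < e -> exists2 d, 0 < d & forall s, 0 <= s -> `|s - t| < d ->
    `|f s - f t| < e.
Proof.
move=> t0 ft e e0; pose l := time_derive f t.
have /cvgrPdist_lt/(_ 1 ltr01) := time_derivable_cvg t0 ft.
rewrite /time_incr /within /= => -[d /= d0 Hd].
pose k := `|l| + 1; have k0 : 0 < k by rewrite ltr_wpDl.
exists (Num.min d (e / k)) => [|s s0]; first by rewrite lt_min d0 divr_gt0.
rewrite lt_min => /andP[sd sk].
have [->|st] := eqVneq s t; first by rewrite subrr normr0.
have := Hd (s - t); rewrite /= sub0r normrN => /(_ sd).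
rewrite subr_eq0 => /(_ st); rewrite subrKC => /(_ s0).
rewrite /time_quotient subrKC -/l => h.
have st0 : s - t != 0 by rewrite subr_eq0.
have -> : f s - f t = (s - t) * ((s - t)^-1 * (f s - f t)) by rewrite mulVKf.
rewrite normrM; apply: le_lt_trans (_ : `|s - t| * k < e);
  last by rewrite -ltr_pdivlMr.
apply: ler_wpM2l => //.
set q := _ * _ in h *.
by have := ler_distD l q 0; rewrite !subr0 distrC /k; lra.
Qed.

Lemma time_derivable_within f s t : 0 <= s ->
  (forall r, 0 <= r -> time_derivable f r) ->
  {within `[s, t], continuous f}.
Proof.
move=> s0 fd; apply/within_continuous_norm => r /=.
rewrite in_itv/= => /andP[sr _] e e0.
have r0 := le_trans s0 sr.
have [d d0 hd] := time_derivable_cont r0 (fd r r0) e0.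
exists d => // q; rewrite /= in_itv/= => /andP[sq _]; apply: hd.
exact: le_trans sq.
Qed.

Lemma time_MVT f s t : (forall r, 0 <= r -> time_derivable f r) ->
  0 <= s -> s < t ->
  exists2 r, s < r < t & f t - f s = time_derive f r * (t - s).
Proof.
move=> fd s0 st.
have [|r rst ->] := @MVT R f (time_derive f) s t st _ (@time_derivable_within f
  s t s0 fd).
  move=> x; rewrite in_itv/= => /andP[sx _].
  by apply: time_derivable_is_derive; [exact: le_lt_trans
    sx|exact/fd/ltW/(le_lt_trans _ sx)].
by exists r.
Qed.

End time_derivative.

(** With [b] the derivative of [a] and k = 4 pi / 3, the energy b^2 / 2 - k / a is conserved and
    positive. So b^2 stays above twice the energy, and [b] cannot change sign by the intermediate
    value theorem. Then a >= 1, and the derivative -k / a^2 of [b] lies in [-k, 0], which yields A =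
    b(0) and the Taylor remainder. The expansion is at the right end point [t] because the polygons
    run backwards in time. *)
Lemma scale_factor_bounds (R : realType) (a : R -> R) : scale_factor a ->
  exists c A : R, [/\ 0 < c,
    forall s, 0 <= s -> 1 + c * s <= a s,
    forall s, 0 <= s -> c <= time_derive a s <= A,
    forall s t, 0 <= s -> s <= t -> 0 <= a t - a s <= A * (t - s) &
    forall s t, 0 <= s -> s <= t ->
      `|a t - a s - time_derive a t * (t - s)| <= (4 * pi / 3) * (t - s) ^+ 2].
Proof.
move=> [a0 ad aeq a01 da0]; set b := time_derive a in ad aeq da0 *.
pose k : R := 4 * pi / 3.
have k0 : 0 < k by rewrite /k divr_gt0// mulr_gt0// pi_gt0.
have ad1 s : 0 <= s -> time_derivable a s by case/ad.
have ad2 s : 0 <= s -> time_derivable b s by case/ad.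
have ba s : 0 <= s -> time_derive b s = - k * (a s) ^- 2.
  by move=> s0; move: (aeq s s0); rewrite -/k => /eqP;
    rewrite addr_eq0 mulNr => /eqP.
pose E s := 2^-1 * (b s * b s) - k * (a s)^-1.
have Ec t : 0 <= t -> E t = E 0.
  rewrite le_eqVlt => /predU1P[<-//|t0].
  have [||c _] := @MVT R E (fun=> 0) 0 t t0.
  - move=> s; rewrite in_itv/= => /andP[s0 _].
    have ha := time_derivable_is_derive s0 (ad1 s (ltW s0)).
    have hb := time_derivable_is_derive s0 (ad2 s (ltW s0)).
    have as0 : a s != 0 by rewrite gt_eqF// a0// ltW.
    have hE := is_deriveB (is_deriveZ 2^-1 (is_deriveM hb hb)) (is_deriveZ k
      (is_deriveV as0 ha)).
    apply: (is_derive_eq hE).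
    rewrite (ba s (ltW s0)) -/b /GRing.scale/=; field; exact: as0.
  - have ca := @time_derivable_within _ a 0 t (lexx 0) ad1.
    have cb := @time_derivable_within _ b 0 t (lexx 0) ad2.
    rewrite continuous_subspace_in => s; rewrite inE/= in_itv/= => /andP[s0 _].
    have as0 : a s != 0 by rewrite gt_eqF// a0.
    apply: cvgB; apply: cvgM.
    + exact: cvg_cst.
    + by apply: cvgM; exact: cb.
    + exact: cvg_cst.
    + by apply: cvgV => //; exact: ca.
  - by rewrite mul0r => /eqP; rewrite subr_eq0 => /eqP.
pose e := 2 * E 0.
have b00 : 0 < b 0 by apply: le_lt_trans da0; exact: sqrtr_ge0.
(* Twice the energy at time 0 is b(0)^2 - 2 k, and the lower bound on b(0) in [scale_factor] is
   exactly sqrt (2 k). *)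
have e0 : 0 < e.
  rewrite /e /E a01 invr1 mulr1.
  have k2 : Num.sqrt (2 * k) ^+ 2 = 2 * k by rewrite sqr_sqrtr// mulr_ge0// ltW.
  have : Num.sqrt (2 * k) < b 0 by rewrite (_ : 2 * k = 8 * pi / 3)// /k; field.
  have := sqrtr_ge0 (2 * k).
  move: k2; set q := Num.sqrt _ => k2 q0 qb; nra.
have b2 s : 0 <= s -> e <= b s * b s.
  move=> s0; rewrite /e -(Ec s s0) /E.
  have : 0 < k * (a s)^-1 by rewrite mulr_gt0// invr_gt0 a0.
  by set q := k * _; lra.
have bpos s : 0 <= s -> 0 < b s.
  rewrite le_eqVlt => /predU1P[<-//|s0].
  rewrite ltNge; apply/negP => bs.
  have cb := @time_derivable_within _ b 0 s (lexx 0) ad2.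
  have [|c] := @IVT R b 0 s 0 (ltW s0) cb.
    by rewrite ge_min bs orbT le_max ltW.
  rewrite in_itv/= => /andP[c0 _] bc.
  by have := b2 c c0; rewrite bc mulr0 leNgt e0.
pose c := Num.min (Num.sqrt e) 1.
have c0 : 0 < c by rewrite lt_min sqrtr_gt0 e0 ltr01.
have cb s : 0 <= s -> c <= b s.
  move=> s0; apply: le_trans (_ : Num.sqrt e <= _);
    first by rewrite ge_min lexx.
  rewrite -(ger0_norm (ltW (bpos s s0))) -sqrtr_sqr ler_wsqrtr// expr2;
    exact: b2.
have a1 s : 0 <= s -> 1 + c * s <= a s.
  rewrite le_eqVlt => /predU1P[<-|s0]; first by rewrite a01 mulr0 addr0.
  have [r /andP[r0 rs]] := time_MVT ad1 (lexx 0) s0.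
  rewrite a01 subr0 => h.
  have := cb r (ltW r0); rewrite -/b in h; nra.
have ai s : 0 <= s -> (a s) ^- 2 <= 1.
  move=> s0; rewrite invf_le1; last by rewrite exprn_gt0// a0.
  by apply: exprn_ege1; apply: le_trans (a1 s s0); rewrite lerDl mulr_ge0// ltW.
have bL s t : 0 <= s -> s <= t -> b t <= b s /\ `|b t - b s| <= k * (t - s).
  move=> s0; rewrite le_eqVlt => /predU1P[<-|st].
    by rewrite !subrr normr0 mulr0.
  have [r /andP[sr rt] h] := time_MVT ad2 s0 st.
  have r0 : 0 <= r by apply: le_trans s0 (ltW sr).
  have hr := ai r r0; have hr0 : 0 <= a r ^- 2
    by rewrite invr_ge0 exprn_ge0// ltW// a0.
  rewrite (ba r r0) in h; split.
    rewrite -subr_le0 h mulNr mulNr oppr_le0; apply: mulr_ge0; last lra.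
    by rewrite mulr_ge0// ltW.
  rewrite h normrM !normrM normrN (gtr0_norm k0) (ger0_norm hr0).
  rewrite gtr0_norm ?subr_gt0//.
  by rewrite ler_pM2r ?subr_gt0// ler_piMr// ltW.
have aM s t : 0 <= s -> s <= t -> exists2 r, s <= r <= t & a t - a s
  = b r * (t - s).
  move=> s0; rewrite le_eqVlt => /predU1P[<-|st].
    by exists s; rewrite ?lexx// !subrr mulr0.
  by have [r /andP[sr rt] ->] := time_MVT ad1 s0 st; exists r; rewrite ?ltW.
exists c, (b 0); split => //.
- by move=> t t0; have [h _] := bL 0 t (lexx 0) t0; rewrite cb//= (le_trans h).
- move=> s t s0 st; have [r /andP[sr rt] ->] := aM s t s0 st.
  have r0 : 0 <= r by exact: le_trans sr.
  rewrite mulr_ge0 ?subr_ge0 ?(ltW (bpos r r0))//= ler_wpM2r ?subr_ge0//.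
  by have [] := bL 0 r (lexx 0) r0.
- move=> s t s0 st; have [r /andP[sr rt] ->] := aM s t s0 st.
  have r0 : 0 <= r by exact: le_trans sr.
  rewrite -mulrBl normrM (ger0_norm (_ : 0 <= t - s)) ?subr_ge0// expr2 mulrA.
  rewrite ler_wpM2r ?subr_ge0// distrC; have [_ h] := bL r t r0 rt.
  by apply: le_trans h _; rewrite ler_pM2l// lerD2l lerN2.
Qed.

(** * Gradient estimates for the periodic Poisson equation *)

(** The second derivative is required at [c] alone. Were it positive, [f1], which vanishes at [c],
    would be positive just to the right, and [f] would increase there. *)
Lemma second_derivative_at_max (R : realType) (f f1 : R -> R) (l c d : R) :
  0 < d -> (forall s, `|s - c| < d -> is_derive s 1 f (f1 s)) ->
  is_derive c 1 f1 l ->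
  (forall s, `|s - c| < d -> f s <= f c) -> l <= 0.
Proof.
move=> d0 hf hf1 fmax; rewrite leNgt; apply/negP => l0.
have inI s : s \in `]c - d, c + d[%R -> `|s - c| < d.
  by rewrite in_itv/= ltr_distl.
have cI : c \in `]c - d, c + d[%R by rewrite in_itv/=; apply/andP; split; lra.
have f1c : f1 c = 0.
  have cd : c - d <= c + d by lra.
  have H : is_derive c 1 f 0.
    apply: (derive1_at_max cd) => // [t /inI/hf ht|t /inI/fmax //].
    exact: ex_derive.
  have H2 : is_derive c 1 f (f1 c) by apply: hf; rewrite subrr normr0.
  by rewrite -(@derive_val _ _ _ _ _ _ _ H2) (@derive_val _ _ _ _ _ _ _ H).
have [e /= e0 he] : exists2 e, 0 < e & forall h, 0 < h < e -> 0 < f1 (c + h).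
  have dc : derivable f1 c 1 by exact: ex_derive.
  have : (fun h => h^-1 *: ((f1 \o shift c) (h *: 1) - f1 c)) @ 0^' --> l.
    by rewrite -(@derive_val _ _ _ _ _ _ _ hf1).
  move=> /cvgrPdist_lt/(_ l l0) [e /= e0 he].
  exists e => // h /andP[h0 hle].
  have /= := he h; rewrite sub0r normrN gtr0_norm// => /(_ hle).
  rewrite gt_eqF// => /(_ isT); rewrite f1c subr0 /shift/= [h *: 1]mulr1 (addrC
    h).
  rewrite /GRing.scale/= => hq; rewrite -(pmulr_rgt0 _ (_ : 0 < h^-1))
    ?invr_gt0//.
  by move: hq; set q := _ * _; have := ler_norm (l - q); lra.
pose h := Num.min (d / 2) (e / 2).
have h0 : 0 < h by rewrite lt_min !divr_gt0.
have hd : h < d by rewrite gt_min; apply/orP; left; lra.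
have he' : h < e by rewrite gt_min; apply/orP; right; lra.
have ch : c < c + h by lra.
have [||r] := @MVT R f f1 c (c + h) ch.
- move=> s; rewrite in_itv/= => /andP[s1 s2]; apply: hf; rewrite ger0_norm; lra.
- apply: derivable_within_continuous => s; rewrite in_itv/= => /andP[s1 s2].
  have := hf s; rewrite ger0_norm ?subr_ge0// => hs.
  have {}hs := hs ltac:(lra); exact: ex_derive.
rewrite in_itv/= => /andP[r1 r2].
have : f (c + h) <= f c by apply: fmax; rewrite ger0_norm; lra.
have : 0 < f1 (c + (r - c)) by apply: he; apply/andP; split; lra.
rewrite subrKC => p1 p2 p3; nra.
Qed.

Lemma derivable_line (R : realType) (V : normedModType R)
    (f : V -> R) (v x : V) : derivable f x v ->
  is_derive (0 : R) 1 (fun s : R => f (x + s *: v)) ('D_v f x).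
Proof.
move=> h; have -> : (fun s : R => f (x + s *: v)) = (fun s => f (s *: v + x)).
  by apply/funext => s; rewrite addrC.
split; first exact: (proj1 (derivable1P f x v) h).
rewrite /derive; set g1 := fun h => h^-1 *: _; set g2 := fun h => h^-1 *: _.
suff -> : g1 = g2 by [].
by rewrite funeqE /g1 /g2 => s /=; rewrite addr0 scale0r add0r [_%:A]mulr1.
Qed.

(** The factor [c] covers both directions along an axis ([c] equal to 1 or -1) as well as segments
    of prescribed length parametrised by [0, 1]. *)
Lemma is_derive_line (R : realType) (V : normedModType R)
    (f f1 : V -> R) (v : V) :
  (forall x, is_derive (0 : R) 1 (fun s : R => f (x + s *: v)) (f1 x)) ->
  forall x (c s : R),
    is_derive s 1 (fun s : R => f (x + (c * s) *: v))
      (c * f1 (x + (c * s) *: v)).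
Proof.
move=> hf x c s; pose F r := f (x + (c * s) *: v + r *: v).
have hF : is_derive (c * (s - s)) 1 F (f1 (x + (c * s) *: v)).
  by rewrite subrr mulr0; exact: hf.
have hg : is_derive s 1 (fun s' => c * (s' - s)) c.
  have := is_deriveZ c (is_deriveB (is_derive_id s 1) (is_derive_cst s s 1)).
  by move/is_derive_eq; apply; rewrite subr0 /GRing.scale/= mulr1.
have := @is_derive1_comp R F (fun r => c * (r - s)) s _ _ hF hg; rewrite mulrC.
by have -> : F \o (fun s' => c * (s' - s)) = (fun s => f (x + (c * s) *: v))
  by apply/funext => r; rewrite /F /= -addrA -scalerDl -mulrDr subrKC.
Qed.

Section periodic_maximum_principle.
Variable R : realType.
Notation E := 'rV[R]_3.
Notation e := (@basis_space R).
Implicit Types (u w : E -> R) (p q : 'I_3 -> E -> R) (x y : E).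

(** The partial derivatives are named explicitly, so that shifts, differences and opposites of [u]
    carry theirs along. Only the pure second derivatives enter, since the Laplacian is all that is
    used. *)
Definition has_second_partials u (p q : 'I_3 -> E -> R) : Prop :=
  continuous u /\ forall i x,
    is_derive (0 : R) 1 (fun s : R => u (x + s *: e i)) (p i x) /\
    is_derive (0 : R) 1 (fun s : R => p i (x + s *: e i)) (q i x).

Definition periodic u : Prop := forall k x, u (x + lattice_vec R k) = u x.

Lemma has_second_partialsN u p q : has_second_partials u p q ->
  has_second_partials (fun x => - u x)
    (fun i x => - p i x) (fun i x => - q i x).
Proof.
move=> [cu hu]; split; first by move=> x; exact: (cvgN (cu x)).
by move=> i x; have [h1 h2] := hu i x; split; exact: is_deriveN.
Qed.

Lemma has_second_partials_shift u p q y : has_second_partials u p q ->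
  has_second_partials (fun x => u (x + y))
    (fun i x => p i (x + y)) (fun i x => q i (x + y)).
Proof.
move=> [cu hu]; split.
  move=> x; apply: (@continuous_comp _ _ _ (fun x => x + y) u); last exact: cu.
  exact: (cvgD cvg_id (cvg_cst y)).
move=> i x; have [h1 h2] := hu i (x + y).
have S (f : E -> R) : (fun s : R => f (x + s *: e i + y)) = (fun s
  => f (x + y + s *: e i)).
  by apply/funext => s; rewrite addrAC.
by rewrite !S.
Qed.

Lemma has_second_partialsB u p q w p' q' :
  has_second_partials u p q -> has_second_partials w p' q' ->
  has_second_partials (fun x => u x - w x) (fun i x => p i x - p' i x)
    (fun i x => q i x - q' i x).
Proof.
move=> [cu hu] [cw hw]; split; first by move=> x; exact: (cvgB (cu x) (cw x)).
by move=> i x; have [h1 h2] := hu i x; have [k1 k2] := hw i x; split;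
  exact: is_deriveB.
Qed.

Lemma compact_unit_cube : compact (@unit_cube R).
Proof.
have := @rV_compact R 3 (fun=> `[0, 1]%classic) (fun=> @segment_compact R 0 1).
by congr compact; apply/seteqP; split => x /= h i; have := h i; rewrite in_itv.
Qed.

Lemma unit_cube_translate x : exists k, unit_cube (x + lattice_vec R k).
Proof.
exists (\row_i - Num.floor (x 0 i)) => i; rewrite !mxE rmorphN /=.
have := floor_itv (x 0 i); rewrite intrD => /andP[h1 h2].
by apply/andP; split; lra.
Qed.

(** Maximum principle for psi(x, z) = u(x + z e) - u(x - z e) on the slab 0 <= z <= d; the
    right-hand side is a barrier equal to 0 at z = 0 and to [kap] at z = d. The second derivatives
    of psi in the k-th space variable and in z are the differences of [q k] and of [q i] between the
    two points x + z e and x - z e. At a positive interior maximum of psi minus the barrier all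
    these differences are nonpositive and the one for [i] is at most -2 M', so the Laplacians at the
    two points differ by more than 2 M. *)
Lemma one_sided_diff_bound u p q (M kap d : R) i :
  has_second_partials u p q -> periodic u -> 0 < d ->
  (forall x, `|\sum_j q j x| <= M) ->
  (forall x, u (x + d *: e i) - u (x - d *: e i) <= kap) ->
  forall x z, 0 <= z <= d ->
    u (x + z *: e i) - u (x - z *: e i) <= M * z * (d - z) + kap * z / d.
Proof.
move=> [cu hu] pu d0 hM hkap x0 z0 /andP[z00 z0d].
rewrite leNgt; apply/negP => hlt.
have z0p : 0 < z0.
  rewrite lt_neqAle z00 andbT; apply/eqP => zE; move: hlt.
  by rewrite -zE !(scale0r, subr0, addr0, subrr, mulr0, mul0r, add0r) ltxx.
pose psi (r : E * R) := u (r.1 + r.2 *: e i) - u (r.1 - r.2 *: e i).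
pose gap := psi (x0, z0) - (M * z0 * (d - z0) + kap * z0 / d).
have gap0 : 0 < gap by rewrite subr_gt0.
(* The enlarged constant makes the final inequality strict; the enlargement is small enough for
   [Phi] to stay at least [gap / 2] at the starting point. *)
pose M' := M + gap / (2 * d ^+ 2).
have d2 : 0 < 2 * d ^+ 2 by rewrite mulr_gt0// exprn_gt0.
have M'M : M < M' by rewrite ltrDl divr_gt0.
pose Phi (r : E * R) := psi r - (M' * r.2 * (d - r.2) + kap * r.2 / d).
have Phi0 : 0 < Phi (x0, z0).
  have -> : Phi (x0, z0) = gap - gap / (2 * d ^+ 2) * z0 * (d - z0).
    have gE : psi (x0, z0) = gap + (M * z0 * (d - z0) + kap * z0 / d)
      by rewrite subrK.
    by rewrite /Phi gE /M' /=; clearbody gap; field; rewrite gt_eqF.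
  have : gap / (2 * d ^+ 2) * z0 * (d - z0) <= gap / 2.
    have -> : gap / 2 = gap / (2 * d ^+ 2) * (d * d) by field; rewrite gt_eqF.
    rewrite -mulrA ler_pM2l ?divr_gt0//; apply: ler_pM => //; lra.
  by lra.
have [r [zr0 zrd Phir Phimax]] : exists r : E * R, [/\ 0 < r.2, r.2 < d,
  0 < Phi r &
    forall y z, 0 <= z <= d -> Phi (y, z) <= Phi r].
  have cA : compact (@unit_cube R `*` `[0, d]%classic).
    by apply: compact_setX; [exact: compact_unit_cube|exact: segment_compact].
  have A0 : (@unit_cube R `*` `[0, d]%classic) !=set0.
    have [k xk] := unit_cube_translate x0.
    by exists (x0 + lattice_vec R k, z0); split => //=; rewrite in_itv/= z00.
  have cPhi : continuous Phi.
    have cline (c : R) : continuous (fun r : E * R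
      => u (r.1 + (c * r.2) *: e i)).
      move=> r; apply: (@continuous_comp _ _ _ (fun r : E * R
        => r.1 + (c * r.2) *: e i) u); last exact: cu.
      apply: cvgD; first exact: cvg_fst.
      by apply: cvgZr_tmp; apply: cvgM; [exact: cvg_cst|exact: cvg_snd].
    have -> : Phi = fun r => u (r.1 + (1 * r.2) *: e i) - u (r.1
      + (- 1 * r.2) *: e i)
        - (M' * r.2 * (d - r.2) + kap * r.2 / d).
      by apply/funext => r; rewrite /Phi /psi mul1r mulN1r scaleNr.
    move=> r; apply: cvgB; first by apply: cvgB; exact: cline.
    have c2 : (r0.2 @[r0 --> r]) --> r.2 by exact: cvg_snd.
    apply: cvgD; last by apply: cvgM; [apply: cvgM => //;
      exact: cvg_cst|exact: cvg_cst].
    apply: cvgM; first by apply: cvgM => //; exact: cvg_cst.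
    by apply: cvgB => //; exact: cvg_cst.
  have [r rA rmax] := compact_EVT_max A0 cA (continuous_subspaceT cPhi).
  move: rA; rewrite inE /= in_itv/= => -[_ /andP[r0 rd]].
  (* By periodicity the maximum over the unit cube is one over all of space, so it is interior in
     the space variables wherever it is attained. *)
  have Pmax y z : 0 <= z <= d -> Phi (y, z) <= Phi r.
    move=> zd; have [k yk] := unit_cube_translate y.
    have -> : Phi (y, z) = Phi (y + lattice_vec R k, z).
      rewrite /Phi /psi /=; congr (_ - _ - _).
        by rewrite addrAC pu.
      by rewrite addrAC pu.
    by apply: rmax; rewrite inE; split => //=; rewrite in_itv.
  have Pr : 0 < Phi r by apply: (lt_le_trans Phi0); apply: Pmax; rewrite z00.
  exists r; split => //.
    rewrite lt_neqAle r0 andbT; apply/eqP => rE; move: Pr.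
    by rewrite /Phi /psi -rE !(scale0r, subr0, addr0, subrr, mulr0, mul0r,
      add0r) oppr0 ltxx.
  rewrite lt_neqAle rd andbT; apply/eqP => rE; move: Pr.
  rewrite /Phi /psi rE subrr mulr0 add0r mulfK ?gt_eqF// subr_gt0 ltNge.
  by rewrite hkap.
case: r zr0 zrd Phir Phimax => x z /= z0' zd _ Phimax.
pose y1 := x + z *: e i; pose y2 := x - z *: e i.
have hk k : q k y1 <= q k y2.
  rewrite -subr_le0.
  apply: (@second_derivative_at_max _ (fun s => u (y1
    + (1 * s) *: e k) - u (y2 + (1 * s) *: e k))
     (fun s => 1 * p k (y1 + (1 * s) *: e k) - 1 * p k (y2
       + (1 * s) *: e k)) _ 0 1) => //.
  - move=> s _; exact: (is_deriveB (is_derive_line (fun y => (hu k y).1) y1 1 s)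
      (is_derive_line (fun y => (hu k y).1) y2 1 s)).
  - apply: (is_derive_eq (is_deriveB
      (is_deriveZ 1 (is_derive_line (fun y => (hu k y).2) y1 1 0))
      (is_deriveZ 1 (is_derive_line (fun y => (hu k y).2) y2 1 0)))).
    by rewrite mulr0 scale0r !addr0 /GRing.scale/= !mul1r.
  - move=> s _; rewrite mulr0 scale0r !addr0.
    have := Phimax (x + (1 * s) *: e k) z; rewrite (ltW z0') (ltW zd)
      => /(_ isT).
    by rewrite lerD2r /psi /= /y1 /y2 ![x + _ *: e k + _]addrAC.
have hi : q i y1 - q i y2 + 2 * M' <= 0.
  pose f s := u (x + (1 * s) *: e i) - u (x + (- 1 * s) *: e i) - (M' * (s * (d
    - s)) + kap / d * s).
  have idd s : is_derive s (1 : R) (fun r : R => M' * (r * (d - r))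
    + kap / d * r) (M' * (d - s - s) + kap / d).
    have h := is_derive_id s (1 : R).
    apply: (is_derive_eq (is_deriveD (is_deriveZ M' (is_deriveM h (is_deriveB
      (is_derive_cst d s 1) h))) (is_deriveZ (kap / d) h))).
    rewrite /GRing.scale/= (_ : (cst d - id) s = d - s)//; ring.
  have -> : q i y1 - q i y2 + 2 * M' = 1 * (1 * q i (x
    + (1 * z) *: e i)) - (- 1) * ((- 1) * q i (x
    + (- 1 * z) *: e i)) - (M' * (0 - 1 - 1) + 0).
    by rewrite !mul1r !mulN1r !scaleNr opprK; ring.
  apply: (@second_derivative_at_max _ f
     (fun s => 1 * p i (x + (1 * s) *: e i) - (- 1) * p i (x
       + (- 1 * s) *: e i) - (M' * (d - s - s) + kap / d))
      _ z (Num.min z (d - z))).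
  - by rewrite lt_min z0' subr_gt0.
  - move=> s _.
    exact: (is_deriveB (is_deriveB (is_derive_line (fun y => (hu i y).1) x 1 s)
      (is_derive_line (fun y => (hu i y).1) x (- 1) s)) (idd s)).
  - have h := is_derive_id z (1 : R).
    exact: (is_deriveB (is_deriveB
       (is_deriveZ 1 (is_derive_line (fun y => (hu i y).2) x 1 z))
       (is_deriveZ (- 1) (is_derive_line (fun y => (hu i y).2) x (- 1) z)))
      (is_deriveD (is_deriveZ M' (is_deriveB (is_deriveB (is_derive_cst d z 1)
        h) h))
        (is_derive_cst (kap / d) z 1))).
  - move=> s; rewrite lt_min => /andP[]; rewrite !ltr_norml
      => /andP[sz1 _] /andP[_ sz2].
    have := Phimax x s; rewrite /Phi /psi /= => /(_ ltac:(apply/andP; split;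
      lra)).
    have FE r : f r = u (x + r *: e i) - u (x - r *: e i) - (M' * r * (d - r)
      + kap * r / d).
      by rewrite /f mul1r mulN1r scaleNr; congr (_ - _ - _); ring.
    by rewrite !FE.
have h1 := hM y1; have h2 := hM y2.
have : \sum_j q j y1 - \sum_j q j y2 <= q i y1 - q i y2.
  rewrite -sumrB (bigD1 i)//= gerDl; apply: sumr_le0 => j _;
    by rewrite subr_le0.
move: h1 h2; rewrite !ler_norml; lra.
Qed.

End periodic_maximum_principle.

Lemma derive_bound_of_diff (R : realType) (f : R -> R) (l C d : R) :
  0 < d -> is_derive (0 : R) 1 f l -> f 0 = 0 ->
  (forall z, 0 < z < d -> `|f z| <= C * z) -> `|l| <= C.
Proof.
move=> d0 hf f0 hC; apply/ler_addgt0Pr => e e0.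
have : (fun h => h^-1 *: ((f \o shift 0) (h *: 1) - f 0)) @ 0^' --> l.
  have dc : derivable f 0 1 by exact: ex_derive.
  by rewrite -(@derive_val _ _ _ _ _ _ _ hf).
move=> /cvgrPdist_lt/(_ e e0) [r /= r0 hr].
pose h := Num.min (d / 2) (r / 2).
have h0 : 0 < h by rewrite lt_min !divr_gt0.
have hd : h < d by rewrite gt_min; apply/orP; left; lra.
have hr' : h < r by rewrite gt_min; apply/orP; right; lra.
have := hr h; rewrite /= sub0r normrN gtr0_norm// => /(_ hr').
rewrite gt_eqF// => /(_ isT); rewrite f0 subr0 /shift/= addr0 [h *: 1]mulr1.
rewrite /GRing.scale/= => hq.
have : `|h^-1 * f h| <= C.
  rewrite normrM ger0_norm ?invr_ge0 ?(ltW h0)// mulrC ler_pdivrMr//.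
  by apply: hC; rewrite h0.
move: hq; set q := _ * _ => hq hC'.
have := ler_normD (l - q) q; rewrite subrK; lra.
Qed.

Section poisson_estimates.
Variable R : realType.
Notation E := 'rV[R]_3.
Notation e := (@basis_space R).
Implicit Types (u w : E -> R) (p q : 'I_3 -> E -> R) (x y : E).

Lemma diff_bound u p q (M kap d : R) i :
  has_second_partials u p q -> periodic u -> 0 < d ->
  (forall x, `|\sum_j q j x| <= M) ->
  (forall x, `|u (x + d *: e i) - u (x - d *: e i)| <= kap) ->
  forall x z, 0 <= z <= d ->
    `|u (x + z *: e i) - u (x - z *: e i)| <= M * z * (d - z) + kap * z / d.
Proof.
move=> hu pu d0 hM hk x z zd; rewrite ler_norml; apply/andP; split.
  have pN : periodic (fun x => - u x) by move=> k y; rewrite pu.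
  have MN y : `|\sum_j - q j y| <= M by rewrite sumrN normrN.
  have kN y : - u (y + d *: e i) - - u (y - d *: e i) <= kap.
    by apply: le_trans (hk y); rewrite opprK addrC distrC ler_norm.
  have := one_sided_diff_bound (has_second_partialsN hu) pN d0 MN kN x zd.
  by rewrite /= opprK lerNl opprB addrC.
apply: (one_sided_diff_bound hu) => // y.
exact: le_trans (ler_norm _) (hk y).
Qed.

Lemma partial_bound_of_diff u p q (C d : R) i x :
  has_second_partials u p q -> 0 < d ->
  (forall z, 0 <= z <= d -> `|u (x + z *: e i) - u (x - z *: e i)| <= C * z) ->
  `|p i x| <= C / 2.
Proof.
move=> [_ hu] d0 hC.
pose f s := u (x + (1 * s) *: e i) - u (x + (- 1 * s) *: e i).
have fE s : f s = u (x + s *: e i) - u (x - s *: e i).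
  by rewrite /f mul1r mulN1r scaleNr.
have := @derive_bound_of_diff R f _ C d d0 (is_deriveB
  (is_derive_line (fun y => (hu i y).1) x 1 0)
  (is_derive_line (fun y => (hu i y).1) x (- 1) 0)).
rewrite fE !mulr0 !scale0r subr0 addr0 subrr.
have -> : 1 * p i x - (- 1) * p i x = p i x * 2 by ring.
rewrite normrM (ger0_norm (_ : 0 <= 2))// => /(_ erefl) H.
rewrite ler_pdivlMr//; apply: H => z /andP[z0 zd].
by rewrite fE; apply: hC; rewrite !ltW.
Qed.

Section solution.
Variables (u : E -> R) (p q : 'I_3 -> E -> R) (N : R).
Hypotheses (hu : has_second_partials u p q) (pu : periodic u).
Hypothesis hN : forall x, `|\sum_j q j x| <= N.

Let N0 : 0 <= N. Proof. exact: le_trans (normr_ge0 _) (hN 0). Qed.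

(** At half a period the points x + e/2 and x - e/2 differ by a lattice vector, so the boundary
    value [kap] is 0. *)
Lemma poisson_diff_bound i x z : 0 <= z <= 2^-1 ->
  `|u (x + z *: e i) - u (x - z *: e i)| <= N / 2 * z.
Proof.
move=> zh; have h0 : 0 < 2^-1 :> R by rewrite invr_gt0.
have /= := diff_bound (i := i) hu pu h0 (kap := 0) hN _ x zh.
rewrite !mul0r addr0 => H; apply: le_trans (H _) _; last first.
  by case/andP: zh => z0 z1; rewrite [leRHS]mulrAC; apply: ler_wpM2l;
    [exact: mulr_ge0|lra].
move=> y; have -> : y + 2^-1 *: e i = y - 2^-1 *: e i
  + lattice_vec R (delta_mx 0 i).
  by rewrite /lattice_vec map_delta_mx; apply/rowP => k; rewrite !mxE; lra.
by rewrite pu subrr normr0.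
Qed.

Lemma poisson_gradient_bound i x : `|p i x| <= N / 4.
Proof.
have := partial_bound_of_diff (d := 2^-1) (C := N / 2) (i := i) (x := x) hu.
rewrite invr_gt0 ltr0n => /(_ isT (poisson_diff_bound i x)).
by rewrite -mulrA -invfM -natrM.
Qed.

(** The function v = u(. + y e_j) - u(. - y e_j) is periodic, has Laplacian at most 2 N and is
    itself at most N y / 2. The bound on its symmetric differences up to distance d then gives a
    partial derivative of at most (2 N d + N y / d) / 2, and d = sqrt y balances the two terms. For
    y > 1/2 the plain gradient bound suffices. *)
Lemma poisson_gradient_holder_axis i j x (y : R) : 0 <= y ->
  `|p i (x + y *: e j) - p i (x - y *: e j)| <= 3 / 2 * N * Num.sqrt y.
Proof.
rewrite le_eqVlt => /predU1P[<-|y0].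
  by rewrite sqrtr0 mulr0 scale0r subr0 addr0 subrr normr0.
have [yh|yh] := leP y 2^-1; last first.
  have s0 : 2^-1 <= Num.sqrt y.
    rewrite -(ger0_norm (_ : 0 <= 2^-1 :> R)) ?invr_ge0// -sqrtr_sqr
      ler_wsqrtr//.
    by apply: le_trans (ltW yh); rewrite expr2; lra.
  apply: le_trans (ler_normB _ _) _.
  have := poisson_gradient_bound i (x + y *: e j).
  have := poisson_gradient_bound i (x - y *: e j).
  have : 3 / 2 * N * 2^-1 <= 3 / 2 * N * Num.sqrt y.
    by apply: ler_wpM2l => //; rewrite mulr_ge0.
  have := N0; lra.
have d0 : 0 < Num.sqrt y by rewrite sqrtr_gt0.
set d := Num.sqrt y in d0 *.
have dd : d * d = y by rewrite -expr2 sqr_sqrtr// ltW.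
have hv := has_second_partialsB (has_second_partials_shift (y *: e j) hu)
  (has_second_partials_shift (- (y *: e j)) hu).
set v := fun x : E => _ in hv; set pv := fun (i : 'I_3) (x : E) => _ in hv.
have vb z : `|v z| <= N / 2 * y by apply: poisson_diff_bound; rewrite (ltW y0).
have pv' : periodic v by move=> k z; rewrite /v (addrAC z) pu (addrAC z) pu.
have db := diff_bound (i := i) (M := 2 * N) (kap := N * y) hv pv' d0.
have -> : 3 / 2 * N * d = (3 * N * d) / 2 by lra.
apply: (partial_bound_of_diff (d := d) hv d0) => z zd.
apply: le_trans (db _ _ x z zd) _.
- move=> x'; rewrite sumrB; apply: le_trans (ler_normB _ _) _.
  by have := hN (x' + y *: e j); have := hN (x' - y *: e j); lra.
- move=> x'; apply: le_trans (ler_normB _ _) _.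
  by have := vb (x' + d *: e i); have := vb (x' - d *: e i); lra.
case/andP: zd => z0 zd.
have -> : N * y * z / d = N * z * d by rewrite -dd; field; rewrite gt_eqF.
have : 0 <= N * z by exact: mulr_ge0.
have -> : 2 * N * z * (d - z) = N * z * (2 * (d - z)) by ring.
have -> : 3 * N * d * z = N * z * (3 * d) by ring.
set r := N * z => r0; nra.
Qed.

(** Three axis-parallel segments join [y] to [x]; the axis estimate is applied at the midpoint of
    each, and 3 times 3/2 is below 5. *)
Lemma poisson_gradient_holder i x y :
  `|p i x - p i y| <= 5 * N * Num.sqrt `|x - y|.
Proof.
have step j z (s : R) : `|s| <= `|x - y| -> `|p i (z + s *: e j) - p i z|
  <= 3 / 2 * N * Num.sqrt `|x - y|.
  wlog s0 : z s / 0 <= s => [hw|] sb.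
    have [s0|s0] := leP 0 s; first exact: hw.
    have s0' : 0 <= - s by rewrite oppr_ge0 ltW.
    have := hw (z + s *: e j) _ s0'.
    by rewrite normrN scaleNr addrK (distrC (p i z)); exact.
  have h := poisson_gradient_holder_axis i j (z
    + (s / 2) *: e j) (divr_ge0 s0 (ler0n _ 2)).
  rewrite addrK -addrA -scalerDl -splitr in h; apply: le_trans h _.
  apply: ler_wpM2l; first by rewrite mulr_ge0.
  rewrite ler_wsqrtr//; apply: le_trans sb; rewrite ger0_norm//; lra.
have xE : x = y + (x - y) 0 0 *: e 0 + (x - y) 0 1 *: e 1
  + (x - y) 0 2%:R *: e 2%:R.
  apply/rowP => k; rewrite !mxE !eqxx/=.
  case: k => [[|[|[|//]]] k3]; rewrite ?mulr1 ?mulr0 ?addr0 -[LHS](subrKC (y 0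
    (Ordinal k3)));
    by congr (_ + (x 0 _ - y 0 _)); exact/val_inj.
have h0 := step 0 y _ (row_le_norm (x - y) 0).
have h1 := step 1 (y + (x - y) 0 0 *: e 0) _ (row_le_norm (x - y) 1).
have h2 := step 2%:R (y + (x - y) 0 0 *: e 0 + (x - y) 0 1 *: e 1) _
  (row_le_norm (x - y) 2%:R).
rewrite -xE in h2.
set r := Num.sqrt _ in h0 h1 h2 *.
have r0 : 0 <= N * r by rewrite mulr_ge0// sqrtr_ge0.
move: h0 h1 h2; rewrite -!mulrA; move: r0; set s := N * r => s0.
set p0 := p i x; set p1 := p i (_ + _ + _); set p2 := p i (_ + _);
  set p3 := p i y.
rewrite !ler_norml; lra.
Qed.

End solution.
End poisson_estimates.

Section poisson_grad.
Variables (R : realType) (w : 'rV[R]_3 -> R) (N : R).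
Hypotheses (hw : Cper_space 2 w) (hN : forall x, `|laplacian w x| <= N).

Lemma Cper_space_second_partials : has_second_partials w
  (fun i => 'D_(basis_space R i) w)
  (fun i => 'D_(basis_space R i) ('D_(basis_space R i) w)).
Proof.
have [] := hw => hc _.
rewrite /= in hc.
case: hc => cw hw1.
split; first exact: cw.
move=> i x.
have [dw] := hw1 i.
move=> [_ hw2].
have [ddw _] := hw2 i.
split.
  exact: (derivable_line (dw x)).
exact: (derivable_line (ddw x)).
Qed.

Lemma grad_bound x : `|grad w x| <= N / 4.
Proof.
have N0 : 0 <= N by exact: le_trans (normr_ge0 _) (hN 0).
rewrite norm_row_le; last by rewrite divr_ge0.
apply/forallP => i; rewrite mxE.
exact: (poisson_gradient_bound Cper_space_second_partials hw.2 hN).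
Qed.

Lemma grad_holder x y : `|grad w x - grad w y| <= 5 * N * Num.sqrt `|x - y|.
Proof.
have N0 : 0 <= N by exact: le_trans (normr_ge0 _) (hN 0).
rewrite norm_row_le; last by rewrite mulr_ge0 ?sqrtr_ge0// mulr_ge0.
apply/forallP => i; rewrite !mxE.
exact: (poisson_gradient_holder Cper_space_second_partials hw.2 hN).
Qed.

End poisson_grad.

(** * Transport along one polygon step *)

(** First-order expansion from partial derivatives alone: the increments are made one direction at a
    time, with the mean value theorem on each segment. The condition on the sum of the [|c i|] keeps
    the whole path in the ball where the partials oscillate by at most [om]. *)
Lemma increments_bound (R : realType) (V : normedModType R) (I : Type)
    (b : I -> V) (h : V -> R) (c D : I -> R) (z : V) (r om : R) :
  (forall i, `|b i| <= 1) ->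
  (forall y i, derivable h y (b i)) ->
  (forall y i, `|y - z| <= r -> `|'D_(b i) h y - D i| <= om) ->
  forall (s : seq I) (y : V), `|y - z| + \sum_(i <- s) `|c i| <= r ->
  `|h (y + \sum_(i <- s) c i *: b i) - h y - \sum_(i <- s) c i * D i|
    <= om * \sum_(i <- s) `|c i|.
Proof.
move=> b1 dh hD; elim=> [|i s IH] y.
  by rewrite !big_nil !addr0 subrr subr0 normr0 mulr0.
rewrite !big_cons => hr.
pose y' := y + c i *: b i.
have cb : `|c i *: b i| <= `|c i| by rewrite normrZ ler_piMr.
have hr' : `|y' - z| + \sum_(j <- s) `|c j| <= r.
  apply: le_trans hr; rewrite addrA lerD2r /y' addrAC.
  exact: le_trans (ler_normD _ _) (lerD (lexx _) cb).
have {}IH := IH y' hr'.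
have S0 : 0 <= \sum_(j <- s) `|c j| by apply: sumr_ge0.
have hline t := is_derive_line (fun x => derivable_line (dh x i)) y (c i) t.
have [|t t01 ht] := @MVT R (fun t => h (y + (c i * t) *: b i))
    (fun t => c i * 'D_(b i) h (y + (c i * t) *: b i)) 0 1 ltr01 (fun t _
      => hline t).
  apply: derivable_within_continuous => t _.
  exact: (@ex_derive _ _ _ _ _ _ _ (hline t)).
move: t01; rewrite in_itv/= => /andP[t0 t1].
rewrite mulr1 mulr0 scale0r addr0 subr0 mulr1 -/y' in ht.
set d := 'D_(b i) h _ in ht.
have hd : `|d - D i| <= om.
  apply: hD; rewrite addrAC; apply: le_trans hr.
  apply: le_trans (ler_normD _ _) _; rewrite lerD2l.
  apply: le_trans (_ : `|c i| <= _); last by rewrite lerDl.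
  rewrite normrZ; apply: le_trans (ler_piMr _ (b1 i)) _ => //.
  by rewrite normrM ler_piMr// ger0_norm ltW.
rewrite addrA -/y'; set H := h (y' + _) in IH *.
have -> : H - h y - (c i * D i + \sum_(j <- s) c j * D j) =
    (H - h y' - \sum_(j <- s) c j * D j) + c i * (d - D i).
  by rewrite mulrBr -ht; ring.
apply: le_trans (ler_normD _ _) _; rewrite [leRHS]mulrDr [leRHS]addrC;
  apply: lerD => //.
by rewrite normrM mulrC ler_wpM2r.
Qed.

Lemma norm_basis_phase (R : realType) j : `|basis_phase R j| <= 1.
Proof.
have e1 i : `|basis_space R i| <= 1.
  rewrite norm_row_le//; apply/forallP => k; rewrite mxE eqxx.
  by case: (k == i); rewrite ?normr1 ?normr0.
by case: j => i; apply: norm_pair_le; rewrite /= ?normr0 ?e1.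
Qed.

Definition phase_coord (R : realType) (z : phase6 R) (j : 'I_3 + 'I_3) : R :=
  match j with inl i => z.1 0 i | inr i => z.2 0 i end.

Lemma big_phase (V : nmodType) (F : 'I_3 + 'I_3 -> V) :
  \sum_j F j = \sum_(i < 3) F (inl i) + \sum_(i < 3) F (inr i).
Proof. exact: big_sumType. Qed.

Lemma phase_coordE (R : realType) (z : phase6 R) :
  z = \sum_j phase_coord z j *: basis_phase R j.
Proof.
rewrite big_phase /=.
case: z => x v /=.
have fstE (s : seq 'I_3) (F : 'I_3 -> phase6 R) : \sum_(i <- s) F i
  = (\sum_(i <- s) (F i).1, \sum_(i <- s) (F i).2).
  by elim: s => [|i s IH]; rewrite ?big_nil// !big_cons IH.
rewrite !fstE /=.
have E (w : 'rV[R]_3) : \sum_(i < 3) w 0 i *: basis_space R i = w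
  by rewrite [RHS]row_sum_delta.
have Z (F : 'I_3 -> R) : \sum_(i < 3) F i *: (0 : 'rV[R]_3) = 0
  by rewrite big1// => i _; rewrite scaler0.
by rewrite !E !Z; congr pair; rewrite /= ?addr0 ?add0r.
Qed.

Lemma common_radius (R : realType) (I : finType) (P : I -> R -> Prop) :
  (forall i d d', 0 < d' -> d' <= d -> P i d -> P i d') ->
  (forall i, exists2 d, 0 < d & P i d) -> exists2 d, 0 < d & forall i, P i d.
Proof.
move=> mono ex.
have [d d0 hd] : exists2 d, 0 < d & forall i, i \in enum I -> P i d.
  elim: (enum I) => [|i s [d d0 hd]]; first by exists 1.
  have [d' d'0 hd'] := ex i.
  exists (Num.min d d') => [|j]; first by rewrite lt_min d0.
  have m0 : 0 < Num.min d d' by rewrite lt_min d0.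
  rewrite inE => /predU1P[->|js]; first by apply: mono hd' => //;
    rewrite ge_min lexx orbT.
  by apply: (mono _ d) => //; [rewrite ge_min lexx|exact: hd].
by exists d => // i; apply: hd; rewrite mem_enum.
Qed.

Section time_phase.
Variables (R : realType) (g : R -> phase6 R -> R).
Hypothesis hg : C1_time_phase g.

Definition time_box (T X V : R) : set (R * phase6 R) :=
  `[0, T]%classic `*` ([set x | `|x| <= X] `*` [set v | `|v| <= V]).

Lemma compact_time_box T X V : compact (time_box T X V).
Proof.
apply: compact_setX; first exact: segment_compact.
by apply: compact_setX; exact: compact_box.
Qed.

Lemma time_box_pos T X V :
  time_box T X V `<=` [set q : R * phase6 R | 0 <= q.1].
Proof. by move=> [t z] [/= + _]; rewrite in_itv/= => /andP[]. Qed.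

Lemma phase_partials_bounded (T X V : R) :
  exists2 M, 0 <= M & forall t z j, 0 <= t <= T -> `|z.1| <= X -> `|z.2| <= V ->
    `|'D_(basis_phase R j) (g t) z| <= M.
Proof.
have [_ _ _ hD] := hg.
(* The bound is encoded as [d^-1], so that [common_radius] also provides one bound for all six
   partials. *)
pose P (j : 'I_3 + 'I_3) (d : R) := forall t z,
  0 <= t <= T -> `|z.1| <= X -> `|z.2| <= V ->
    `|'D_(basis_phase R j) (g t) z| <= d^-1.
have [] := @common_radius R ('I_3 + 'I_3)%type P.
- move=> j d d' d'0 d'd hd t z tT zX zV; apply: le_trans (hd t z tT zX zV) _.
  by rewrite lef_pV2// posrE (lt_le_trans d'0).
- move=> j; have [M M0 hM] := bounded_on_compact (@compact_time_box T X V)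
    (@time_box_pos T X V) (hD j).2.
  exists (M + 1)^-1; first by rewrite invr_gt0 ltr_wpDl.
  move=> t z tT zX zV; rewrite invrK.
  by have := hM (t, z); rewrite /time_box /= in_itv/= tT
    => /(_ (conj isT (conj zX zV))); lra.
by move=> d d0 hd; exists d^-1 => [|t z j]; [rewrite invr_ge0 ltW|exact: hd].
Qed.

(** First-order expansion backwards in time, uniform on a compact box. The time increment is taken
    at [z'] and the phase increment at time [s]; each involves derivatives within [om] of those at
    [(s, z)]. *)
Lemma time_phase_increment (T X V om : R) : 0 < om ->
  exists2 r, 0 < r & forall s h z z', 0 < h -> h < r -> 0 <= s - h -> s <= T ->
    `|z.1| <= X -> `|z.2| <= V -> \sum_j `|phase_coord (z' - z) j| < r ->
    `|g (s - h) z' - g s z + h * time_derive (g ^~ z) s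
       - \sum_j phase_coord (z' - z) j * 'D_(basis_phase R j) (g s) z|
    <= om * (h + \sum_j `|phase_coord (z' - z) j|).
Proof.
move=> om0; have [_ hdt hct hD] := hg.
(* The margin 1 keeps [z'] inside the box, as [r] will be at most 1. *)
have cK := @compact_time_box T (X + 1) (V + 1).
have KA := @time_box_pos T (X + 1) (V + 1).
have [d1 d10 hd1] := uniformly_continuous_on_compact cK KA hct om0.
pose P (j : 'I_3 + 'I_3) (d : R) := forall p q,
  time_box T (X + 1) (V + 1) p -> time_box T (X + 1) (V + 1) q
    -> `|q - p| < d ->
  `|'D_(basis_phase R j) (g q.1) q.2 - 'D_(basis_phase R j) (g p.1) p.2| < om.
have [||d2 d20 hd2] := @common_radius R ('I_3 + 'I_3)%type P.
- move=> j d d' d'0 d'd hd p q Kp Kq pq; apply: hd => //;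
    exact: lt_le_trans d'd.
- move=> j; have [d d0 hd] := uniformly_continuous_on_compact cK KA (hD j).2
    om0.
  by exists d.
exists (Num.min 1 (Num.min d1 d2)) => [|s h z z' h0];
  first by rewrite !lt_min ltr01 d10.
rewrite !lt_min => /and3P[h1 hhd1 hhd2] sh0 sT zX zV /and3P[c1 cd1 cd2].
set C := \sum_j `|_| in c1 cd1 cd2 *.
have zz' : z' = z + \sum_j phase_coord (z' - z) j *: basis_phase R j.
  by rewrite -phase_coordE subrKC.
have nzz' : `|z' - z| <= C.
  rewrite (phase_coordE (z' - z)); apply: le_trans (ler_norm_sum _ _ _) _.
  by apply: ler_sum => j _; rewrite normrZ ler_piMr// norm_basis_phase.
have inK y t : `|y - z| <= C -> 0 <= t <= T -> time_box T (X + 1) (V + 1) (t,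
  y).
  move=> yz tT; rewrite /time_box /= in_itv/= tT; split => //.
  have y1 : `|y.1 - z.1| <= `|y - z| by rewrite (prod_normE (y - z)) le_max
    lexx.
  have y2 : `|y.2 - z.2| <= `|y - z| by rewrite (prod_normE (y - z)) le_max
    lexx orbT.
  split => /=; [rewrite -[y.1](subrK z.1)|rewrite -[y.2](subrK z.2)];
    by apply: le_trans (ler_normD _ _) _; lra.
have s0 : 0 <= s by lra.
have sT' : 0 <= s <= T by rewrite s0.
have C0 : 0 <= C by apply: sumr_ge0.
have zK : time_box T (X + 1) (V + 1) (s, z) by apply: inK;
  rewrite ?subrr ?normr0.
have [xi /andP[xi1 xi2] hxi] := @time_MVT R (g ^~ z') (s - h) s (fun r r0
  => hdt r z' r0) sh0 ltac:(lra).
rewrite subKr in hxi.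
have A1 : `|time_derive (g ^~ z') xi - time_derive (g ^~ z) s| <= om.
  apply/ltW/(hd1 (s, z) (xi, z')) => //.
    by apply: inK => //; apply/andP; split; lra.
  apply: norm_pair_lt => /=; last exact: le_lt_trans cd1.
  rewrite ltr_norml; apply/andP; split; lra.
have A2 := @increments_bound R _ _ (@basis_phase R) (g s) (phase_coord (z' - z))
  (fun j => 'D_(basis_phase R j) (g s) z) z C om (@norm_basis_phase R)
  (fun y j => (hD j).1 s y s0) _ (index_enum _) z.
rewrite -zz' subrr normr0 add0r -/C in A2.
have {}A2 := A2 _ (lexx C).
have {}A2 : `|g s z' - g s z - \sum_j phase_coord (z' - z) j * 'D_(basis_phase
  R j) (g s) z| <= om * C.
  apply: A2 => y j yz.
  apply/ltW/(hd2 j (s, z) (s, y)) => //; first exact: inK.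
  by apply: norm_pair_lt => /=; rewrite ?subrr ?normr0//;
    exact: le_lt_trans cd2.
set S := \sum_j _ * _ in A2 *.
have -> : g (s - h) z' - g s z + h * time_derive (g^~ z) s - S =
  (g s z' - g s z - S) - (time_derive (g^~ z') xi - time_derive (g^~ z) s) * h.
  by rewrite mulrBl -hxi; ring.
apply: le_trans (ler_normB _ _) _; rewrite [leRHS]mulrDr [leRHS]addrC;
  apply: lerD => //.
by rewrite normrM (gtr0_norm h0) ler_pM2r.
Qed.

End time_phase.

(** * Euclidean scalar product measured in the max norm *)

Lemma dot_bound (R : realType) (x y : 'rV[R]_3) :
  `|dot x y| <= 3 * (`|x| * `|y|).
Proof.
rewrite /dot !big_ord_recr big_ord0 /= add0r.
have H i j : `|x 0 i * y 0 j| <= `|x| * `|y|.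
  by rewrite normrM; apply: ler_pM => //; exact: row_le_norm.
apply: le_trans (ler_normD _ _) _; apply: le_trans (lerD (ler_normD _ _) (lexx
  _)) _.
set i0 := widen_ord _ _; set i1 := widen_ord _ _; set i2 := ord_max.
have := H i0 i0; have := H i1 i1; have := H i2 i2; lra.
Qed.

Lemma dotC (R : realType) (x y : 'rV[R]_3) : dot x y = dot y x.
Proof. by apply: eq_bigr => i _; rewrite mulrC. Qed.

Lemma dotDl (R : realType) (x y z : 'rV[R]_3) :
  dot (x + y) z = dot x z + dot y z.
Proof. by rewrite -big_split; apply: eq_bigr => i _; rewrite mxE mulrDl. Qed.

Lemma dotZl (R : realType) (c : R) (x z : 'rV[R]_3) :
  dot (c *: x) z = c * dot x z.
Proof. by rewrite /dot big_distrr /=; apply: eq_bigr => i _; rewrite mxE mulrA.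
  Qed.

Lemma dotDr (R : realType) (x y z : 'rV[R]_3) :
  dot z (x + y) = dot z x + dot z y.
Proof. by rewrite dotC dotDl !(dotC z). Qed.

Lemma dotZr (R : realType) (c : R) (x z : 'rV[R]_3) :
  dot z (c *: x) = c * dot z x.
Proof. by rewrite dotC dotZl (dotC z). Qed.

Lemma sqnorm_bound (R : realType) (x : 'rV[R]_3) : sqnorm x <= 3 * `|x| ^+ 2.
Proof. by apply: le_trans (ler_norm _) _; rewrite expr2; exact: dot_bound. Qed.

Lemma sqnorm_ge0 (R : realType) (x : 'rV[R]_3) : 0 <= sqnorm x.
Proof. by apply: sumr_ge0 => i _; rewrite -expr2 sqr_ge0. Qed.

Lemma norm2_le_sqnorm (R : realType) (x : 'rV[R]_3) : `|x| ^+ 2 <= sqnorm x.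
Proof.
suff : `|x| <= Num.sqrt (sqnorm x).
  move=> h; rewrite -(sqr_sqrtr (sqnorm_ge0 x)) ler_pXn2r// nnegrE//;
    exact: sqrtr_ge0.
rewrite norm_row_le ?sqrtr_ge0//; apply/forallP => i.
rewrite -sqrtr_sqr ler_wsqrtr// /sqnorm /dot (bigD1 i)//= -expr2 lerDl.
by apply: sumr_ge0 => j _; rewrite -expr2 sqr_ge0.
Qed.

Lemma sqnormD (R : realType) (x y : 'rV[R]_3) :
  sqnorm (x + y) = sqnorm x + 2 * dot x y + sqnorm y.
Proof. by rewrite /sqnorm dotDl !dotDr (dotC y x); ring. Qed.

Lemma sqnormZ (R : realType) (c : R) (x : 'rV[R]_3) :
  sqnorm (c *: x) = c ^+ 2 * sqnorm x.
Proof. by rewrite /sqnorm dotZl dotZr mulrA expr2. Qed.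

Lemma continuous_sqnorm (R : realType) : continuous (@sqnorm R).
Proof.
have -> : @sqnorm R = fun x => x 0 0 * x 0 0 + x 0 1 * x 0 1
  + x 0 2%:R * x 0 2%:R.
  apply/funext => x; rewrite /sqnorm /dot !big_ord_recr big_ord0 /= add0r.
  by congr (x 0 _ * x 0 _ + x 0 _ * x 0 _ + x 0 _ * x 0 _); exact/val_inj.
move=> x; have c i := @coord_continuous R 1 3 0 i x.
exact: (cvgD (cvgD (cvgM (c 0) (c 0)) (cvgM (c 1) (c 1))) (cvgM (c 2%:R) (c
  2%:R))).
Qed.

(** * Increments of the background profile *)

Section profile.
Variables (R : realType) (H : R -> R).
Hypothesis HH : admissible_profile H.

Lemma profile_continuous : continuous H.
Proof.
move=> s; apply: differentiable_continuous; apply/derivable1_diffP.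
by have [[dH _] _ _ _] := HH; exact: dH.
Qed.

Lemma profile_MVT (p q : R) : exists2 r, `|r - p| <= `|q - p| &
  H q - H p = derive1 H r * (q - p).
Proof.
have [[dH _] _ _ _] := HH.
have isd (r : R) : is_derive r 1 H (derive1 H r).
  by rewrite derive1E; exact: derivableP.
have cH a b : {within `[a, b], continuous H}.
  by apply: continuous_subspaceT; exact: profile_continuous.
have [pq|qp|->] := ltgtP p q.
- have [r] := MVT pq (fun r _ => isd r) (cH p q).
  rewrite in_itv/= => /andP[r1 r2] h; exists r => //.
  by rewrite !gtr0_norm ?subr_gt0//; lra.
- have [r] := MVT qp (fun r _ => isd r) (cH q p).
  rewrite in_itv/= => /andP[r1 r2] h; exists r.
    by rewrite !ltr0_norm ?subr_lt0//; lra.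
  by rewrite -opprB h -mulrN opprB.
- by exists q => //; rewrite !subrr mulr0.
Qed.

Lemma profile_derive_bounded (Z : R) :
  exists2 M, 0 <= M & forall s, `|s| <= Z -> `|derive1 H s| <= M.
Proof.
have [[_ cH] _ _ _] := HH.
have [M M0 hM] := @bounded_on_compact R R setT `[- Z, Z]%classic (derive1 H)
  (@segment_compact R (- Z) Z) (fun _ _ => I) (continuous_subspaceT cH).
by exists M => // s sZ; apply: hM; rewrite /= in_itv/= -ler_norml.
Qed.

Lemma profile_support : exists2 S, 0 <= S & forall s, S < s -> H s = 0.
Proof.
have [_ cS _ _] := HH.
have /compact_bounded [S [_ hS]] := cS.
exists (Num.max 0 (S + 1)) => [|s]; first by rewrite le_max lexx.
rewrite gt_max => /andP[s0 sS]; apply/eqP; apply: contraT => Hs.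
have := hS (S + 1) ltac:(lra) s (subset_closure _).
by rewrite /= => /(_ Hs); rewrite gtr0_norm// leNgt sS.
Qed.

Lemma profile_increment (Y B err : R) : 0 <= Y -> 0 <= B -> 0 < err ->
  exists2 h0, 0 < h0 & forall h (w F : 'rV[R]_3), 0 < h -> h < h0 ->
    `|w| <= Y -> `|F| <= B ->
    `|H (sqnorm (w + h *: F)) - H (sqnorm w)
       - h * (2 * derive1 H (sqnorm w) * dot w F)| <= err * h.
Proof.
move=> Y0 B0 err0; have [[_ cH] _ _ _] := HH.
(* For [h <= 1] the increment [D] of [sqnorm] is at most [h * Q], and [Z] bounds every argument at
   which the derivative of [H] is taken. The constant [k] below controls the quadratic part of [D],
   which contributes at most [k * h ^+ 2]. *)
pose Q : R := 6 * (Y * B) + 3 * B ^+ 2.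
have Q0 : 0 <= Q by rewrite addr_ge0// mulr_ge0// ?mulr_ge0// exprn_ge0.
pose Z : R := 3 * Y ^+ 2 + Q.
have [M M0 hM] := profile_derive_bounded Z.
have w0 : 0 < err / (2 * (Q + 1)) by rewrite divr_gt0// mulr_gt0// ltr_wpDl.
have [d d0 hd] := @uniformly_continuous_on_compact R R setT `[- Z, Z]%classic
  (derive1 H) (@segment_compact R (- Z) Z) (fun _ _
    => I) (continuous_subspaceT cH) _ w0.
pose k : R := M * (3 * B ^+ 2).
have k0 : 0 <= k by rewrite mulr_ge0// mulr_ge0// exprn_ge0.
exists (Num.min 1 (Num.min (d / (Q + 1)) (err / (2 * (k + 1))))) => [|h w F h0].
  by rewrite !lt_min ltr01 !divr_gt0// ?mulr_gt0// ltr_wpDl.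
rewrite !lt_min ltr_pdivlMr ?ltr_wpDl// ltr_pdivlMr ?mulr_gt0 ?ltr_wpDl//.
move=> /and3P[h1 hd1 hk] wY FB.
have w2 : sqnorm w <= 3 * Y ^+ 2.
  by apply: le_trans (sqnorm_bound w) _; rewrite ler_pM2l// ler_pXn2r// nnegrE.
have F2 : sqnorm F <= 3 * B ^+ 2.
  by apply: le_trans (sqnorm_bound F) _; rewrite ler_pM2l// ler_pXn2r// nnegrE.
have wF : `|dot w F| <= 3 * (Y * B).
  by apply: le_trans (dot_bound w F) _; rewrite ler_pM2l// ler_pM.
have sw0 := sqnorm_ge0 w; have sF0 := sqnorm_ge0 F.
rewrite sqnormD dotZr sqnormZ.
set p := sqnorm w in w2 sw0 *; set f := sqnorm F in F2 sF0 *;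
  set c := dot w F in wF *.
pose D := 2 * (h * c) + h ^+ 2 * f.
have hf : h * f <= 3 * B ^+ 2.
  apply: le_trans F2; rewrite ler_piMl//; exact: ltW.
have hf0 : 0 <= h * f by rewrite mulr_ge0// ltW.
have DE : D = h * (2 * c + h * f) by rewrite /D; ring.
have Dh : `|D| <= h * Q.
  rewrite DE normrM gtr0_norm// ler_pM2l// /Q.
  by move: wF; rewrite !ler_norml => /andP[c1 c2]; apply/andP; split; lra.
have hQ : h * Q <= Q by rewrite ler_piMl// ltW.
have [r rp] := profile_MVT p (p + D).
have -> : p + D - p = D by rewrite addrC addKr.
rewrite (addrC p) addrK in rp.
have rD : `|r - p| <= h * Q by exact: le_trans Dh.
have pZ : - Z <= p <= Z by rewrite /Z; apply/andP; split; lra.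
have rZ : - Z <= r <= Z.
  move: rD; rewrite ler_norml /Z => /andP[r1 r2]; apply/andP; split; lra.
have rd : `|r - p| < d.
  apply: le_lt_trans rD _; apply: le_lt_trans hd1; rewrite ler_pM2l//; lra.
have h1' : `|derive1 H r - derive1 H p| < err / (2 * (Q + 1)).
  by apply: hd => //=; rewrite in_itv.
have h2' : `|derive1 H p| <= M by apply: hM; rewrite ler_norml.
have -> : p + 2 * (h * c) + h ^+ 2 * f = p + D by rewrite addrA.
move=> ->.
have -> : derive1 H r * D - h * (2 * derive1 H p * c) =
  (derive1 H r - derive1 H p) * D + h * (derive1 H p * (h * f)).
  by rewrite /D; ring.
apply: le_trans (ler_normD _ _) _.
have e1 : `|(derive1 H r - derive1 H p) * D| <= err / 2 * h.
  rewrite normrM; apply: le_trans (ler_pM _ _ (ltW h1') Dh) _ => //.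
  have -> : err / (2 * (Q + 1)) * (h * Q) = err / 2 * h * (Q / (Q + 1)).
    by field; rewrite gt_eqF// ltr_wpDl.
  rewrite ler_piMr//; first by rewrite mulr_ge0 ?divr_ge0 ?ltW//.
  by rewrite ler_pdivrMr ?ltr_wpDl//; lra.
have e2 : `|h * (derive1 H p * (h * f))| <= err / 2 * h.
  rewrite normrM gtr0_norm// mulrC ler_pM2r// normrM (ger0_norm hf0).
  have : `|derive1 H p| * (h * f) <= M * (h * (3 * B ^+ 2)).
    apply: ler_pM => //; rewrite ler_pM2l//.
  have -> : M * (h * (3 * B ^+ 2)) = h * k by rewrite /k; ring.
  by move: (`|_| * _) => X; lra.
have -> : err * h = err / 2 * h + err / 2 * h by field.
exact: lerD.
Qed.

End profile.

Definition phase_density (R : realType) (a H : R -> R) (g : R -> phase6 R -> R)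
    (t : R) (x w : 'rV[R]_3) : R :=
  H (sqnorm w) + g t (x, (a t)^-1 *: w).

Section transport_step.
Variables (R : realType) (a H : R -> R) (g : R -> phase6 R -> R).
Variable (W : R -> 'rV[R]_3 -> R).
Hypotheses (Ha : scale_factor a) (HH : admissible_profile H).
Hypotheses (hg : C1_time_phase g).
Hypothesis hV : forall t x v, 0 <= t -> vlasov_eq a H g W t x v.

(** Backwards in time the velocity v = w / a changes by h q with q = (F + b v) / a, up to a
    remainder [rho] of order h^2. The terms of order h in the expansions of g and of H(|w|^2) are
    those of the Vlasov equation, whose source is the derivative of H(|w|^2) in the direction F, and
    they cancel. Three remainders of [err / 3 * h] are left. *)
Lemma transport_step (T X Y B err : R) : 0 <= Y -> 0 <= B -> 0 < err ->
  exists2 h0, 0 < h0 & forall s h x w,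
    0 < h -> h < h0 -> 0 <= s - h -> s <= T ->
    `|x| <= X -> `|w| <= Y -> `|grad (W s) x| <= B ->
    `|phase_density a H g (s - h) (x - (h / (a s) ^+ 2) *: w)
        (w + h *: grad (W s) x)
      - phase_density a H g s x w| <= err * h.
Proof.
move=> Y0 B0 err0; have [c [A [c0 aL bA aA aT]]] := scale_factor_bounds Ha.
set k : R := 4 * pi / 3 in aT.
have k0 : 0 <= k by rewrite divr_ge0// mulr_ge0// pi_ge0.
have A0 : 0 <= A by have /andP[b1 b2] := bA 0 (lexx 0);
  apply/ltW/(lt_le_trans c0)/(le_trans b1).
have a1 s : 0 <= s -> 1 <= a s.
  by move=> s0; apply: le_trans (aL s s0); rewrite lerDl mulr_ge0// ltW.
have [M M0 hM] := phase_partials_bounded hg T X Y.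
(* [Cr * h ^+ 2], [Cv * h] and [C1 * h] will bound [rho], the change of velocity and the sum of the
   six phase increments. *)
pose Cr := Y * (k + A * A) + B * A.
have Cr0 : 0 <= Cr by rewrite addr_ge0// mulr_ge0// addr_ge0// mulr_ge0.
pose Cv := B + A * Y + Cr.
have Cv0 : 0 <= Cv by apply: addr_ge0 => //; apply: addr_ge0 => //;
  exact: mulr_ge0.
pose C1 := 3 * (Y + Cv).
have C10 : 0 <= C1 by rewrite mulr_ge0// addr_ge0.
have om0 : 0 < err / (3 * (1 + C1)) by rewrite divr_gt0//; lra.
have [r r0 hr] := time_phase_increment hg T X Y om0.
have [h1 h10 hH] := profile_increment HH Y0 B0 (divr_gt0 err0 (ltr0Sn _ 2)).
pose k2 := 3 * (Cr * M).
have k20 : 0 <= k2 by rewrite mulr_ge0// mulr_ge0.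
have C1p : 0 < 1 + C1 by lra.
have k2p : 0 < 3 * (k2 + 1) by lra.
exists (Num.min (Num.min 1 (r / (1 + C1))) (Num.min h1 (err / (3 * (k2 + 1))))).
  by rewrite !lt_min ltr01 h10 !divr_gt0.
move=> s h x w h0; rewrite !lt_min ltr_pdivlMr// ltr_pdivlMr//.
move=> /andP[/andP[hl1 hlr] /andP[hlh hlk]] sh0 sT xX wY FB.
have s0 : 0 <= s by lra.
set F := grad (W s) x in FB *.
pose ia := (a s)^-1; pose ia' := (a (s - h))^-1.
have as1 := a1 s s0; have as1' := a1 _ sh0.
have as0 : 0 < a s by lra.
have as0' : 0 < a (s - h) by lra.
have ia0 : 0 <= ia by rewrite invr_ge0 ltW.
have ia0' : 0 <= ia' by rewrite invr_ge0 ltW.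
have ia1 : ia <= 1 by rewrite invf_le1.
have ia1' : ia' <= 1 by rewrite invf_le1.
pose b := time_derive a s; pose De := a s - a (s - h).
have bA' : `|b| <= A.
  by have /andP[b1 b2] := bA s s0; rewrite ger0_norm// (le_trans _ b1)// ltW.
have shs : s - h <= s by lra.
have De1 : `|De| <= A * h.
  by have /andP[d0 d1] := aA _ _ sh0 shs; rewrite subKr in d1;
    rewrite ger0_norm.
have De2 : `|De - b * h| <= k * h ^+ 2.
  by have := aT _ _ sh0 shs; rewrite subKr.
have iaD : ia' - ia = ia * (ia' * De).
  by rewrite /ia /ia' /De; field; rewrite !gt_eqF.
have prod1 u : `|ia * u| <= `|u|.
  by rewrite normrM (ger0_norm ia0) ler_piMl.
have prod1' u : `|ia' * u| <= `|u|.
  by rewrite normrM (ger0_norm ia0') ler_piMl.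
have iaD1 : `|ia' - ia| <= A * h.
  by rewrite iaD; apply: le_trans (prod1 _) _; exact: le_trans (prod1' _) De1.
have iaD2 : `|ia' - ia - h * (ia * (ia * b))| <= (k + A * A) * h ^+ 2.
  have -> : ia' - ia - h * (ia * (ia * b)) =
      ia * (ia' * (De - b * h)) + ia * (b * h * (ia' - ia)).
    by rewrite {1}iaD; ring.
  apply: le_trans (ler_normD _ _) _; rewrite mulrDl lerD//.
    by apply: le_trans (prod1 _) _; exact: le_trans (prod1' _) De2.
  apply: le_trans (prod1 _) _; rewrite !normrM (gtr0_norm h0).
  have -> : A * A * h ^+ 2 = A * h * (A * h) by ring.
  by apply: ler_pM => //; rewrite ?mulr_ge0 ?(ltW h0)// ler_pM2r.
pose v := ia *: w; pose w' := w + h *: F; pose v' := ia' *: w'.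
pose x' := x - (h / (a s) ^+ 2) *: w.
pose q := ia *: (F + b *: v).
pose rho := v' - v - h *: q.
have rhoE : rho = (ia' - ia - h * (ia * (ia * b))) *: w + (h * (ia' - ia)) *: F.
  by rewrite /rho /q /v' /w' /v; apply/rowP => i; rewrite !mxE; ring.
have rhoB : `|rho| <= h ^+ 2 * Cr.
  rewrite rhoE; apply: le_trans (ler_normD _ _) _; rewrite !normrZ.
  have -> : h ^+ 2 * Cr = (k + A * A) * h ^+ 2 * Y + h * (A * h) * B
    by rewrite /Cr; ring.
  apply: lerD; first exact: ler_pM.
  by apply: ler_pM => //; rewrite (gtr0_norm h0) ler_pM2l.
have vY : `|v| <= Y by rewrite normrZ (ger0_norm ia0); apply: le_trans wY;
  rewrite ler_piMl.
have qB : `|q| <= B + A * Y.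
  rewrite normrZ (ger0_norm ia0); apply: le_trans (_ : `|F + b *: v| <= _).
    by rewrite ler_piMl.
  by apply: le_trans (ler_normD _ _) _; rewrite normrZ lerD// ler_pM.
have vv : `|v' - v| <= h * Cv.
  have -> : v' - v = h *: q + rho by rewrite /rho subrKC.
  apply: le_trans (ler_normD _ _) _; rewrite normrZ (gtr0_norm h0) /Cv mulrDr.
  apply: lerD; first by rewrite ler_pM2l.
  apply: le_trans rhoB _; rewrite expr2 -mulrA ler_pM2l//.
  by rewrite ler_piMl// ltW.
have ha2 : 0 <= h / a s ^+ 2 by rewrite divr_ge0 ?exprn_ge0// ltW.
have xx : `|x' - x| <= h * Y.
  rewrite /x' addrAC subrr add0r normrN normrZ (ger0_norm ha2);
    apply: ler_pM => //.
  by rewrite ler_pdivrMr ?exprn_gt0// ler_peMr ?(ltW h0)// exprn_ege1.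
pose z : phase6 R := (x, v); pose z' : phase6 R := (x', v').
have SC : \sum_j `|phase_coord (z' - z) j| <= h * C1.
  rewrite big_phase /=.
  have E (u : 'rV[R]_3) d : `|u| <= d -> \sum_(i < 3) `|u 0 i| <= 3 * d.
    move=> ud; have -> : 3 * d = \sum_(i < 3) d
      by rewrite !big_ord_recr big_ord0 /=; ring.
    by apply: ler_sum => i _; apply: le_trans (row_le_norm u i) ud.
  have -> : h * C1 = 3 * (h * Y) + 3 * (h * Cv) by rewrite /C1; ring.
  by apply: lerD; apply: E.
have hC1 : h * C1 <= h * (1 + C1) by rewrite ler_pM2l//; lra.
have hh1 : h <= h * (1 + C1) by rewrite ler_peMr ?(ltW h0)//; lra.
have G := hr s h z z' h0 (le_lt_trans hh1 hlr) sh0 sT xX vY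
  (le_lt_trans (le_trans SC hC1) hlr).
have {G} : `|g (s - h) z' - g s z + h * time_derive (g ^~ z) s
       - \sum_j phase_coord (z' - z) j * 'D_(basis_phase R j) (g s) z|
           <= err / 3 * h.
  apply: le_trans G _.
  have -> : err / 3 * h = err / (3 * (1 + C1)) * (h + h * C1).
    by field; rewrite gt_eqF// ltr_pwDl.
  by rewrite ler_pM2l// lerD2l.
have -> : \sum_j phase_coord (z' - z) j * 'D_(basis_phase R j) (g s) z =
    dot (x' - x) (grad_x (g s) z) + dot (v' - v) (grad_v (g s) z).
  rewrite big_phase /=; congr (_ + _); apply: eq_bigr => i _; congr (_ * _);
    by rewrite [RHS]mxE.
have -> : dot (x' - x) (grad_x (g s) z) = - h * (ia * dot v (grad_x (g s) z)).
  have -> : x' - x = (- h * ia) *: v.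
    by rewrite /x' addrAC subrr add0r /v scalerA -scaleNr /ia; congr (_ *: _);
      field; rewrite gt_eqF.
  by rewrite dotZl mulrA.
have -> : v' - v = h *: q + rho by rewrite /rho subrKC.
rewrite dotDl (dotZl h q) /q (dotZl ia (F + b *: v)).
have rG : `|dot rho (grad_v (g s) z)| <= err / 3 * h.
  have gM : `|grad_v (g s) z| <= M.
    rewrite norm_row_le//; apply/forallP => i; rewrite mxE.
    by apply: hM => //; rewrite s0.
  apply: le_trans (dot_bound _ _) _.
  apply: le_trans (_ : h ^+ 2 * k2 <= _).
    have -> : h ^+ 2 * k2 = 3 * (h ^+ 2 * Cr * M) by rewrite /k2; ring.
    by rewrite ler_pM2l// ler_pM.
  have -> : h ^+ 2 * k2 = h * k2 * h by ring.
  by rewrite ler_pM2r//; lra.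
have := hH h w F h0 hlh wY FB.
have := hV x v s0; rewrite /vlasov_eq -/z -/F -/ia -/b.
have -> : a s ^+ 2 * sqnorm v = sqnorm w.
  by rewrite /v sqnormZ /ia; field; rewrite gt_eqF.
have -> : 2 * a s * derive1 H (sqnorm w) * dot v F
  = 2 * derive1 H (sqnorm w) * dot w F.
  by rewrite /v dotZl /ia; field; rewrite gt_eqF.
set tg := time_derive _ s; set gx := dot v (grad_x _ _);
  set gv := dot (F + _) _.
move=> pde.
rewrite /phase_density -/ia -/ia' -/v -/w' -/v' -/x' -/z -/z'.
move: rG; set rg := dot rho _ => rG.
set h1' := H (sqnorm w'); set h2 := H (sqnorm w); set g1 := g (s - h) z';
  set g2 := g s z.
move=> E1 E2.
have -> : h1' + g1 - (h2 + g2) = (h1' - h2 - h * (2 * derive1 H (sqnorm w) *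
  dot w F)) +
   (g1 - g2 + h * tg - (- h * (ia * gx) + (h * (ia * gv) + rg))) + rg.
  by rewrite -pde; ring.
have -> : err * h = err / 3 * h + err / 3 * h + err / 3 * h by field.
apply: le_trans (ler_normD _ _) _; apply: lerD => //;
  apply: le_trans (ler_normD _ _) _. exact: (lerD E1 E2).
Qed.

End transport_step.

(** * Euler polygons *)

(* Backward Euler polygon for x' = w / a^2, w' = - F(t, x), started at time t;
   vertex k is at time t - k h. *)
Fixpoint polygon (R : realType) (a : R -> R) (F : R -> 'rV[R]_3 -> 'rV[R]_3)
    (t h : R) (z : phase6 R) (k : nat) : phase6 R :=
  if k is k'.+1 then
    let q := polygon a F t h z k' in
    let s := t - k'%:R * h in
    (q.1 - (h / a s ^+ 2) *: q.2, q.2 + h *: F s q.1)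
  else z.

Section growth_weight.
Variables (R : realType) (c C M : R).
Hypotheses (c0 : 0 < c) (C0 : 0 < C) (M0 : 0 < M).

(* M exp(C K), where K is the primitive of (1 + c s)^(-3/2) vanishing at 0 *)
Definition growth_weight (s : R) : R :=
  M * expR (C * (2 / c * (1 - (Num.sqrt (1 + c * s))^-1))).

Lemma growth_weight_gt0 s : 0 < growth_weight s.
Proof. by rewrite mulr_gt0// expR_gt0. Qed.

Lemma growth_weight_le s : growth_weight s <= M * expR (C * (2 / c)).
Proof.
rewrite ler_pM2l// ler_expR ler_pM2l//.
apply: ler_piMr; first by rewrite divr_ge0// ltW.
by rewrite lerBlDr lerDl invr_ge0 sqrtr_ge0.
Qed.

Lemma growth_weight_homo s t : 0 <= s -> s <= t ->
  growth_weight s <= growth_weight t.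
Proof.
move=> s0 st; rewrite ler_pM2l// ler_expR ler_pM2l// ler_pM2l ?divr_gt0//.
have h s' : 0 <= s' -> 0 < 1 + c * s' by move=> ?;
  rewrite ltr_pwDl// mulr_ge0// ltW.
rewrite lerD2l lerN2 lef_pV2 ?posrE ?sqrtr_gt0 ?h ?(le_trans s0 st)//.
by rewrite ler_wsqrtr// lerD2l ler_pM2l.
Qed.

(** Discrete form of S' = C (1 + c s)^(-3/2) S: summed over the vertices of a polygon, the
    right-hand side telescopes. The factor 2 pays for the discretisation. *)
Lemma growth_weight_step s h : 0 <= h -> 0 <= s - h -> C * h <= 1 ->
  h * growth_weight s / ((1 + c * s) * Num.sqrt (1 + c * s))
    <= 2 / C * (growth_weight s - growth_weight (s - h)).
Proof.
move=> h0 sh Ch; have s0 : 0 <= s by lra.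
have Lh s' : 0 <= s' -> 1 <= 1 + c * s' by move=> ?;
  rewrite lerDl mulr_ge0// ltW.
pose p := Num.sqrt (1 + c * s); pose p' := Num.sqrt (1 + c * (s - h)).
have p1' : 1 <= p' by rewrite -(sqrtr1 R) ler_wsqrtr// Lh.
have pp' : p' <= p.
  by rewrite ler_wsqrtr// lerD2l ler_pM2l//; lra.
have pE : p * p = 1 + c * s by rewrite -expr2 sqr_sqrtr// (le_trans ler01)// Lh.
have pE' : p' * p' = 1 + c * (s - h) by rewrite -expr2 sqr_sqrtr// (le_trans
  ler01)// Lh.
have p0 : 0 < p by lra. have p0' : 0 < p' by lra.
have pd : (p - p') * (p + p') = c * h.
  by rewrite (_ : _ * _ = p * p - p' * p'); [rewrite pE pE'|]; ring.
(* [d] is the logarithm of the ratio of the weights at [s] and [s - h]. It is at least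
   [C * h / (p * p * p)], as the rate (1 + c s)^(-3/2) decreases. *)
pose d := C * (2 / c * (p'^-1 - p^-1)).
have dE : d = C * (2 * h / (p * p' * (p + p'))).
  rewrite /d; congr (C * _).
  have -> : p'^-1 - p^-1 = (p - p') / (p * p') by field; rewrite !gt_eqF.
  have -> : p - p' = c * h / (p + p') by rewrite -pd mulfK// gt_eqF// addr_gt0.
  by field; rewrite !gt_eqF// addr_gt0.
have q2 : 2 <= p * p' * (p + p') by nra.
have d0 : 0 <= d.
  rewrite dE; apply: mulr_ge0; first exact: ltW.
  by apply: divr_ge0; [rewrite mulr_ge0|lra].
have d1 : d <= 1.
  apply: le_trans Ch; rewrite dE ler_pM2l// ler_pdivrMr; last by lra.
  by rewrite mulrC ler_wpM2l.
have dl : C * h / (p * p * p) <= d.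
  rewrite dE -mulrA ler_pM2l//.
  rewrite ler_pdivrMr; last by rewrite !mulr_gt0.
  rewrite mulrAC ler_pdivlMr; last by lra.
  have q3 : p * p' * (p + p') <= 2 * (p * p * p).
    have -> : 2 * (p * p * p) = p * p * (p + p) by ring.
    by apply: ler_pM; rewrite ?mulr_ge0 ?addr_ge0 ?(ltW p0) ?(ltW p0')//
      ?lerD2l// ler_pM2l.
  by rewrite (mulrC 2 h) -[leRHS]mulrA ler_wpM2l.
have We : growth_weight (s - h) = growth_weight s * expR (- d).
  rewrite /growth_weight -[RHS]mulrA -expRD -/p -/p'; congr (_ * expR _).
  by rewrite /d; ring.
rewrite -/p -pE We.
have W0 := growth_weight_gt0 s; set w := growth_weight s in W0 *.
(* exp(-d) <= 1 / (1 + d) <= 1 - d / 2 for d in [0, 1]; this is where [C * h <= 1] enters. *)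
have ed : expR (- d) <= 1 - d / 2.
  rewrite expRN; have := expR_ge1Dx d => e1.
  apply: le_trans (_ : (1 + d)^-1 <= _).
    have e2 := expR_gt0 d; by rewrite lef_pV2 ?posrE//; lra.
  have d1' : 0 <= d * (1 - d) by rewrite mulr_ge0// subr_ge0.
  by rewrite -[leLHS]mul1r ler_pdivrMr; lra.
have -> : h * w / (p * p * p) = w * C^-1 * (C * h / (p * p * p)).
  by field; rewrite !gt_eqF.
apply: le_trans (_ : w * C^-1 * d <= _).
  by rewrite ler_pM2l// mulr_gt0// invr_gt0.
have -> : 2 / C * (w - w * expR (- d)) = w * C^-1 * (2 * (1 - expR (- d)))
  by ring.
apply: ler_wpM2l; last by move: ed; set x := expR _ => ed; lra.
by rewrite mulr_ge0 ?invr_ge0 ?ltW.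
Qed.

End growth_weight.

Section polygon_divergence.
Variables (R : realType) (a : R -> R) (F : R -> 'rV[R]_3 -> 'rV[R]_3).
Variables (c C M Cf t : R) (n : nat).
Hypotheses (c0 : 0 < c) (C0 : 0 < C) (M0 : 0 < M) (Cf0 : 0 <= Cf).
Hypotheses (t0 : 0 <= t) (n0 : (0 < n)%N).
Hypothesis aL : forall s, 0 <= s -> 1 + c * s <= a s.
Notation S := (growth_weight c C M).
Hypothesis hF : forall s x y, 0 <= s <= t ->
  `|F s x - F s y| <= Cf * S s / (1 + c * s) * Num.sqrt `|x - y|.
Notation h := (t / n%:R).
Hypothesis hsmall : C * h <= 1.
Notation gam := (Cf * Num.sqrt (2 / c) * (2 / C)).
Hypothesis gam_small : gam * S t <= 2^-1.

Let L1 s : 0 <= s -> 1 <= 1 + c * s.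
Proof. by move=> ?; rewrite lerDl mulr_ge0// ltW. Qed.

Let gam0 : 0 <= gam.
Proof. by rewrite !mulr_ge0 ?sqrtr_ge0 ?invr_ge0// ltW. Qed.

(** The two bounds feed each other. As long as the shifts differ by at most [K], the momenta differ
    by at most 2 K, and summing 2 K / a^2 bounds the distance of the positions by 2 K / (c (1 + c
    s)). The Hoelder bound then makes the forces differ by O(S (1 + c s)^(-3/2)), which
    [growth_weight_step] sums; [gam_small] keeps the total below [K]. *)
Lemma polygon_divergence_step (x w w' : 'rV[R]_3) (K : R) :
  1 <= K -> `|w - w'| <= K ->
  forall k, (k <= n)%N ->
  let z := polygon a F t h (x, w) k in let z' := polygon a F t h (x, w') k in
  let s := t - k%:R * h in
  `|z.2 - w - (z'.2 - w')| <= gam * K * (S t - S s) /\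
  `|z.1 - z'.1| <= 2 * K / c * ((1 + c * s)^-1 - (1 + c * t)^-1).
Proof.
move=> K1 ww'; have K0 : 0 <= K by lra.
have nR : 0 < n%:R :> R by rewrite ltr0n.
have h0 : 0 <= h by rewrite divr_ge0.
elim=> [|k IH] kn; first by rewrite /= mul0r subr0 !subrr mulr0 mulr0 normr0.
have [] := IH (ltnW kn).
set z := polygon _ _ _ _ (x, w) k; set z' := polygon _ _ _ _ (x, w') k.
move=> /= V E; rewrite -/z -/z'.
set s := t - k%:R * h in V E *.
have -> : t - k.+1%:R * h = s - h by rewrite /s -natr1; ring.
have sh0 : 0 <= s - h.
  have -> : s - h = t - k.+1%:R * h by rewrite /s -natr1; ring.
  by rewrite subr_ge0 mulrA ler_pdivrMr// mulrC ler_wpM2l// ler_nat.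
have s0 : 0 <= s by lra.
have st : s <= t by rewrite gerBl mulr_ge0.
have st' : 0 <= s <= t by rewrite s0.
have Ss0 := growth_weight_gt0 c C M0 s.
have Sst : S s <= S t by exact: growth_weight_homo.
have Ls := L1 s0; have Lt := L1 t0; have Lsh := L1 sh0; have asL := aL s0.
have D2 : `|z.2 - z'.2| <= 2 * K.
  have -> : z.2 - z'.2 = (z.2 - w - (z'.2 - w')) + (w - w').
    by apply/rowP => i; rewrite !mxE; ring.
  apply: le_trans (ler_normD _ _) _.
  suff : gam * K * (S t - S s) <= K by lra.
  have -> : gam * K * (S t - S s) = K * (gam * (S t - S s)) by ring.
  rewrite ler_piMr//; apply: le_trans (_ : gam * S t <= _);
    last by apply: le_trans gam_small _; lra.
  by rewrite ler_wpM2l// gerBl ltW.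
have E' : `|z.1 - z'.1| <= 2 * K / c / (1 + c * s).
  apply: le_trans E _; rewrite ler_wpM2l ?divr_ge0 ?mulr_ge0 ?(ltW c0)//.
  by rewrite gerBl invr_ge0; lra.
split.
- have -> : z.2 + h *: F s z.1 - w - (z'.2 + h *: F s z'.1 - w') =
     (z.2 - w - (z'.2 - w')) + h *: (F s z.1 - F s z'.1).
    by apply/rowP => i; rewrite !mxE; ring.
  apply: le_trans (ler_normD _ _) _; rewrite normrZ (ger0_norm h0).
  have -> : gam * K * (S t - S (s - h)) = gam * K * (S t - S s)
    + gam * K * (S s - S (s - h)) by ring.
  apply: lerD => //.
  (* Here sqrt K is replaced by K, which needs [1 <= K] and makes the estimate linear in the initial
     distance. *)
  have sq : Num.sqrt `|z.1 - z'.1| <= K * Num.sqrt (2 / c) / Num.sqrt (1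
    + c * s).
    have -> : K * Num.sqrt (2 / c) / Num.sqrt (1 + c * s)
      = Num.sqrt (K ^+ 2 * (2 / c) / (1 + c * s)).
      have cc : 0 <= 2 / c by rewrite divr_ge0// ltW.
      rewrite [RHS]sqrtrM; last by rewrite mulr_ge0 ?exprn_ge0.
      by rewrite [Num.sqrt (K ^+ 2 * _)]sqrtrM ?exprn_ge0// sqrtr_sqr
        (ger0_norm K0) sqrtrV//; lra.
    apply: ler_wsqrtr; apply: le_trans E' _.
    apply: ler_wpM2r; first by rewrite invr_ge0; lra.
    have -> : 2 * K / c = K * (2 / c) by ring.
    by rewrite ler_wpM2r ?divr_ge0 ?(ltW c0)// expr2 ler_peMr.
  apply: le_trans (ler_wpM2l h0 (hF _ _ st')) _.
  have st3 := @growth_weight_step R c C M c0 C0 M0 s h h0 sh0 hsmall.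
  have p0 : 0 < Num.sqrt (1 + c * s) by rewrite sqrtr_gt0; lra.
  apply: le_trans (_ : h * (Cf * S s / (1 + c * s) * (K * Num.sqrt (2 / c) /
    Num.sqrt (1 + c * s))) <= _).
    apply: ler_wpM2l => //; apply: ler_wpM2l => //; apply: divr_ge0;
      last by lra.
    by apply: mulr_ge0 => //; exact: ltW.
  have -> : h * (Cf * S s / (1 + c * s) * (K * Num.sqrt (2 / c) / Num.sqrt (1
    + c * s))) =
     Cf * Num.sqrt (2 / c) * K * (h * S s / ((1 + c * s) * Num.sqrt (1
       + c * s))).
    have L0 : 1 + c * s != 0 by rewrite gt_eqF//; lra.
    move: p0; set p := Num.sqrt (1 + c * s) => p0;
      move: (Num.sqrt (2 / c)) (S s) (t / _) => y1 y2 y3.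
    by field; rewrite L0 gt_eqF.
  have -> : gam * K * (S s - S (s - h)) = Cf * Num.sqrt (2 / c) * K * (2 / C *
    (S s - S (s - h))) by ring.
  by rewrite ler_wpM2l// !mulr_ge0 ?sqrtr_ge0.
- have -> : z.1 - (h / a s ^+ 2) *: z.2 - (z'.1 - (h / a s ^+ 2) *: z'.2) =
     (z.1 - z'.1) - (h / a s ^+ 2) *: (z.2 - z'.2).
    by apply/rowP => i; rewrite !mxE; ring.
  apply: le_trans (ler_normB _ _) _.
  have -> : 2 * K / c * ((1 + c * (s - h))^-1 - (1 + c * t)^-1) =
    2 * K / c * ((1 + c * s)^-1 - (1 + c * t)^-1) + 2 * K / c * ((1
      + c * (s - h))^-1 - (1 + c * s)^-1) by ring.
  apply: lerD => //.
  have a0 : 0 < a s by lra.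
  have ha0 : 0 <= h / a s ^+ 2 by rewrite divr_ge0// exprn_ge0// ltW.
  rewrite normrZ (ger0_norm ha0).
  apply: le_trans (ler_wpM2l ha0 D2) _.
  (* The weight 1 / a^2 is at most 1 / ((1 + c (s - h)) (1 + c s)), whose sum telescopes. *)
  have -> : 2 * K / c * ((1 + c * (s - h))^-1 - (1 + c * s)^-1) =
     h / ((1 + c * (s - h)) * (1 + c * s)) * (2 * K).
    by move: sh0 Lsh Ls; move: (t / _) => y1 ? ? ?; field; rewrite !gt_eqF//;
      lra.
  apply: ler_wpM2r; first by rewrite mulr_ge0.
  apply: ler_wpM2l => //.
  rewrite lef_pV2 ?posrE ?exprn_gt0//; last by apply: mulr_gt0; lra.
  rewrite expr2; apply: ler_pM => //; [lra|lra|].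
  apply: le_trans asL; rewrite lerD2l ler_pM2l//; lra.
Qed.

Lemma polygon_divergence (x w w' : 'rV[R]_3) (K : R) :
  1 <= K -> `|w - w'| <= K ->
  let P w := (polygon a F t h (x, w) n).2 in
  `|P w - w - (P w' - w')| <= gam * K * S t.
Proof.
move=> K1 ww' /=; have [+ _] := polygon_divergence_step x K1 ww' (leqnn n).
move=> h1; apply: le_trans h1 _; apply: ler_wpM2l; first by rewrite mulr_ge0//;
  lra.
by rewrite gerBl ltW// growth_weight_gt0.
Qed.

(* Since w |-> P w - w is a contraction at large scale, w - P w improves on w.
  *)
Lemma polygon_reaches_unit_ball (x : 'rV[R]_3) :
  exists w, `|(polygon a F t h (x, w) n).2| <= 1.
Proof.
pose P w := (polygon a F t h (x, w) n).2.
suff H j w : `|P w| <= 2 ^+ j -> exists w, `|P w| <= 1.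
  apply: (H (Num.bound `|P 0|) 0).
  have := archi_boundP (normr_ge0 (P 0)) => /ltW /le_trans; apply.
  by rewrite -natrX ler_nat ltnW// ltn_expl.
elim: j w => [|j IH] w; first by rewrite expr0; exists w.
move=> Pw; apply: (IH (w - P w)).
pose K := Num.max 1 `|P w|.
have K1 : 1 <= K by rewrite le_max lexx.
have wK : `|w - P w - w| <= K by rewrite addrAC subrr add0r normrN le_max lexx
  orbT.
have := polygon_divergence x K1 wK; rewrite -/(P w) -/(P (w - P w)) /=.
have -> : P (w - P w) - (w - P w) - (P w - w) = P (w - P w).
  by apply/rowP => i; rewrite !mxE; ring.
move=> /le_trans; apply.
have KJ : K <= 2 ^+ j.+1 by rewrite ge_max Pw exprn_ege1// ler1n.
have -> : gam * K * S t = K * (gam * S t) by ring.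
apply: le_trans (_ : K * 2^-1 <= _); first by rewrite ler_wpM2l//; lra.
by rewrite ler_pdivrMr// mulrC -exprS.
Qed.

End polygon_divergence.

Section polygon_transport.
Variables (R : realType) (a H : R -> R) (g : R -> phase6 R -> R).
Variables (W : R -> 'rV[R]_3 -> R) (t B : R).
Hypotheses (Ha : scale_factor a) (HH : admissible_profile H).
Hypotheses (hg : C1_time_phase g).
Hypothesis hV : forall t x v, 0 <= t -> vlasov_eq a H g W t x v.
Hypotheses (t0 : 0 <= t) (B0 : 0 <= B).
Hypothesis hB : forall s x, 0 <= s <= t -> `|grad (W s) x| <= B.
Notation F := (fun s => grad (W s)).

Let a1 s : 0 <= s -> 1 <= a s.
Proof.
move=> s0; have [c [A [c0 aL _ _ _]]] := scale_factor_bounds Ha.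
by apply: le_trans (aL s s0); rewrite lerDl mulr_ge0// ltW.
Qed.

Lemma polygon_bounds (x w : 'rV[R]_3) (n k : nat) : (0 < n)%N -> (k <= n)%N ->
  let z := polygon a F t (t / n%:R) (x, w) k in
  [/\ 0 <= t - k%:R * (t / n%:R), `|z.2 - w| <= t * B &
     `|z.1| <= `|x| + t * (`|w| + t * B)].
Proof.
move=> n0 kn; set h := t / n%:R.
have nR : 0 < n%:R :> R by rewrite ltr0n.
have h0 : 0 <= h by rewrite divr_ge0.
have kh m : (m <= n)%N -> m%:R * h <= t.
  by move=> mn; rewrite mulrA ler_pdivrMr// mulrC ler_wpM2l// ler_nat.
have tB : 0 <= t * B by rewrite mulr_ge0.
have wB : 0 <= `|w| + t * B by rewrite addr_ge0.
suff H' : forall m, (m <= n)%N -> let z := polygon a F t h (x, w) m in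
    `|z.2 - w| <= m%:R * h * B /\ `|z.1| <= `|x| + m%:R * h * (`|w| + t * B).
  have [h2 h1] := H' k kn; split; first by rewrite subr_ge0 kh.
    by apply: le_trans h2 _; rewrite ler_wpM2r// kh.
  by apply: le_trans h1 _; rewrite lerD2l ler_wpM2r// kh.
elim=> [|m IH] mn /=; first by rewrite !mul0r subrr normr0 addr0.
have [h2 h1] := IH (ltnW mn).
set z := polygon _ _ _ _ _ m in h1 h2 *.
have mh := kh m (ltnW mn).
have s0 : 0 <= t - m%:R * h by rewrite subr_ge0.
have st : 0 <= t - m%:R * h <= t by rewrite s0 gerBl mulr_ge0.
rewrite -natr1; split.
  rewrite addrAC; apply: le_trans (ler_normD _ _) _;
    rewrite mulrDl mul1r mulrDl lerD//.
  by rewrite normrZ (ger0_norm h0) ler_wpM2l// hB.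
apply: le_trans (ler_normB _ _) _; rewrite (mulrDl _ 1) mul1r (mulrDl _ h)
  addrA; apply: lerD => //.
have a0 := a1 s0; set s := t - _ in s0 st a0 *.
have ha0 : 0 <= h / a s ^+ 2 by rewrite divr_ge0// exprn_ge0//; lra.
rewrite normrZ (ger0_norm ha0); apply: ler_pM => //.
  by rewrite ler_pdivrMr ?exprn_gt0//; [rewrite ler_peMr// exprn_ege1|lra].
rewrite -(subrKC w z.2); apply: le_trans (ler_normD _ _) _; rewrite lerD2l.
by apply: le_trans h2 _; rewrite ler_wpM2r.
Qed.

(** An error of [err / t] per unit of time adds up to [err]. All vertices of all polygons with
    [|w| <= Y] lie in one box, so one step size from [transport_step] serves them all, and the
    number of steps does not depend on [w]. *)
Lemma polygon_transport (x : 'rV[R]_3) (Y err : R) :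
  0 < t -> 0 <= Y -> 0 < err ->
  exists n0 : nat, forall n w, (n0 < n)%N -> `|w| <= Y ->
    let z := polygon a F t (t / n%:R) (x, w) n in
    `|phase_density a H g 0 z.1 z.2 - phase_density a H g t x w| <= err.
Proof.
move=> tp Y0 err0.
have tB : 0 <= t * B by rewrite mulr_ge0.
pose Y' := Y + t * B; pose X' := `|x| + t * Y'.
have Y'0 : 0 <= Y' by rewrite addr_ge0.
have [h0 h00 hstep] := @transport_step R a H g W Ha HH hg hV t X' Y' B (err /
  t) Y'0 B0 (divr_gt0 err0 tp).
exists (Num.bound (t / h0)) => n w nn wY /=.
have n0 : (0 < n)%N by apply: leq_ltn_trans nn.
have nR : 0 < n%:R :> R by rewrite ltr0n.
set h := t / n%:R.
have hp : 0 < h by rewrite divr_gt0.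
have hh0 : h < h0.
  rewrite ltr_pdivrMr// mulrC -ltr_pdivrMr//.
  apply: lt_le_trans (archi_boundP _) _; first by rewrite divr_ge0// ltW.
  by rewrite ler_nat ltnW.
suff H' k : (k <= n)%N -> let z := polygon a F t h (x, w) k in
    `|phase_density a H g (t - k%:R * h) z.1 z.2 - phase_density a H g t x w|
      <= k%:R * h * (err / t).
  have := H' n (leqnn n); rewrite /= (_ : n%:R * h = t) ?subrr.
    by rewrite mulrCA divff ?mulr1 ?gt_eqF.
  by rewrite /h mulrCA divff ?mulr1// gt_eqF.
elim: k => [|k IH] kn /=; first by rewrite !mul0r subr0 subrr normr0.
have {}IH := IH (ltnW kn).
have [s0 z2 z1] := polygon_bounds x w n0 (ltnW kn).
have [s0' _ _] := polygon_bounds x w n0 kn.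
move: IH z1 z2 s0 s0'; rewrite -/h /=.
set z := polygon _ _ _ _ _ k; set s := t - k%:R * h => IH z1 z2 s0.
have -> : t - k.+1%:R * h = s - h by rewrite /s -natr1; ring.
move=> sh0.
have st : s <= t by rewrite gerBl mulr_ge0// ltW.
have zY : `|z.2| <= Y'.
  by rewrite -(subrKC w z.2); apply: le_trans (ler_normD _ _) _; exact: lerD.
have zX : `|z.1| <= X'.
  by apply: le_trans z1 _; rewrite lerD2l ler_wpM2l// lerD2r.
have zB : `|grad (W s) z.1| <= B by apply: hB; rewrite s0.
have := hstep s h z.1 z.2 hp hh0 sh0 st zX zY zB.
set p := phase_density _ _ _ (s - h) _ _; set q := phase_density _ _ _ s _ _ in
  IH *.
set r := phase_density _ _ _ t _ _ in IH * => E.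
apply: le_trans (ler_distD q _ _) _.
have -> : k.+1%:R * h * (err / t) = err / t * h + k%:R * h * (err / t)
  by rewrite -natr1; ring.
exact: lerD.
Qed.

End polygon_transport.

(** * Bootstrap *)

Section density_estimate.
Variables (R : realType) (H : R -> R) (HH : admissible_profile H).

Lemma continuous_profile_affine (al : R) (c : 'rV[R]_3) :
  continuous (fun v : 'rV[R]_3 => H (sqnorm (al *: v + c))).
Proof.
move=> v; apply: (@continuous_comp _ _ _ (fun v : 'rV[R]_3
  => sqnorm (al *: v + c)) H);
  last exact: profile_continuous.
apply: (@continuous_comp _ _ _ (fun v : 'rV[R]_3 => al *: v + c) (@sqnorm R));
  last exact: continuous_sqnorm.
exact: (cvgD (@scaler_continuous _ _ al v) (cvg_cst c)).
Qed.

Lemma profile_affine_support (al : R) (c : 'rV[R]_3) : 0 < al ->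
  exists u, forall v, u < `|v| -> H (sqnorm (al *: v + c)) = 0.
Proof.
move=> al0; have [S S0 hS] := profile_support HH.
exists ((1 + S + `|c|) / al) => v; rewrite ltr_pdivrMr// => hv; apply: hS.
apply: lt_le_trans (norm2_le_sqnorm _).
have : 1 + S < `|al *: v + c|.
  have := ler_normB (al *: v + c) c; rewrite addrK normrZ (gtr0_norm al0); lra.
set q := `|_| => hq; nra.
Qed.

Lemma integral_profile_affine (al : R) (c : 'rV[R]_3) : 0 < al ->
  integral3 setT (fun v => H (sqnorm (al *: v + c))) = al ^- 3.
Proof.
move=> al0; have [_ _ _ H1] := HH.
have [u hu] := profile_affine_support 0 (ltr01 : 0 < 1 :> R).
have E v : H (sqnorm (1 *: v + 0)) = H (sqnorm v) by rewrite scale1r addr0.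
have cH : continuous (fun v : 'rV[R]_3 => H (sqnorm v)).
  have := @continuous_profile_affine 1 0.
  by under eq_fun do rewrite E.
rewrite (@integral3_affine R (fun v => H (sqnorm v)) u)//;
  first by rewrite H1 mulr1.
by move=> v /hu; rewrite E.
Qed.

(** The integral of H(|al v + c|^2) does not depend on [c], so the integral of [gam] is unchanged
    when the profile is added and its translate subtracted. What remains is the difference bounded
    by the hypothesis, read in the variable w = al v. *)
Lemma density_estimate (al u : R) (gam : 'rV[R]_3 -> R) (c w1 : 'rV[R]_3)
    (K Y k1 k2 : R) :
  0 < al -> continuous gam -> (forall v, u < `|v| -> gam v = 0) ->
  0 <= K -> 0 <= Y ->
  (forall w, `|H (sqnorm w) + gam (al^-1 *: w) - H (sqnorm (w + c))| <=
     k1 * (`|w - w1| <= K)%R%:R + k2 * (`|w| <= Y)%R%:R) ->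
  `|integral3 setT gam| <= al ^- 3 * (k1 * (2 * K) ^+ 3 + k2 * (2 * Y) ^+ 3).
Proof.
move=> al0 cg hg K0 Y0 hle.
pose h0 v := H (sqnorm (al *: v + 0)); pose h1 v := H (sqnorm (al *: v + c)).
have ch0 : continuous h0 by exact: continuous_profile_affine.
have ch1 : continuous h1 by exact: continuous_profile_affine.
have [u0 hu0] := @profile_affine_support al 0 al0.
have [u1 hu1] := @profile_affine_support al c al0.
pose D v := gam v + h0 v - h1 v.
have cD : continuous D.
  move=> v; exact: (cvgB (cvgD (cg v) (ch0 v)) (ch1 v)).
pose uD := Num.max u (Num.max u0 u1).
have hD v : uD < `|v| -> D v = 0.
  rewrite !gt_max => /and3P[a1 a2 a3].
  by rewrite /D hg// /h0 hu0// /h1 hu1// addr0 subr0.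
have : integral3 setT gam + integral3 setT h0 = integral3 setT D
  + integral3 setT h1.
  rewrite -(integral3D cg hg ch0 hu0) -(integral3D cD hD ch1 hu1).
  by congr integral3; apply/funext => v; rewrite /D subrK.
rewrite /h0 /h1 !integral_profile_affine// => /addIr ->.
have -> : al ^- 3 * (k1 * (2 * K) ^+ 3 + k2 * (2 * Y) ^+ 3) =
  k1 * (2 * (K / al)) ^+ 3 + k2 * (2 * (Y / al)) ^+ 3 by field; rewrite gt_eqF.
have al0' := ltW al0.
apply: (@le_integral3_box R D uD (al^-1 *: w1) 0) => //;
  rewrite ?divr_ge0// => v.
have := hle (al *: v); rewrite scalerA mulVf ?gt_eqF// scale1r.
have -> : D v = H (sqnorm (al *: v)) + gam v - H (sqnorm (al *: v + c)).
  by rewrite /D /h0 /h1 addr0 (addrC (gam v)).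
have scl (w : 'rV[R]_3) d : (`|v - al^-1 *: w| <= d / al) = (`|al *: v - w|
  <= d).
  have -> : v - al^-1 *: w = al^-1 *: (al *: v - w).
    by rewrite scalerBr scalerA mulVf ?gt_eqF// scale1r.
  by rewrite normrZ gtr0_norm ?invr_gt0// mulrC ler_pM2r ?invr_gt0.
by rewrite (scl w1); have := scl 0 Y; rewrite scaler0 !subr0 => ->.
Qed.

End density_estimate.

Lemma norm_le_enorm (R : realType) (v : 'rV[R]_3) : `|v| <= enorm v.
Proof. by rewrite -(ger0_norm (normr_ge0 v)) -sqrtr_sqr ler_wsqrtr//
  norm2_le_sqnorm. Qed.

Lemma profile_sqnorm_lipschitz (R : realType) (H : R -> R) (Z : R) :
  admissible_profile H -> 0 <= Z ->
  exists2 L, 0 <= L & forall p q : 'rV[R]_3, `|p| <= Z -> `|q| <= Z ->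
    `|H (sqnorm p) - H (sqnorm q)| <= L * `|p - q|.
Proof.
move=> HH Z0; have [M M0 hM] := profile_derive_bounded HH (6 * Z ^+ 2).
exists (M * (6 * Z)) => [|p q pZ qZ]; first by rewrite mulr_ge0// mulr_ge0.
have sq x : `|x| <= Z -> 0 <= sqnorm x <= 3 * Z ^+ 2.
  move=> xZ; rewrite sqnorm_ge0/=; apply: le_trans (sqnorm_bound x) _.
  by rewrite ler_pM2l// ler_pXn2r// nnegrE.
have /andP[p0 p1] := sq p pZ; have /andP[q0 q1] := sq q qZ.
have [r rq ->] := profile_MVT HH (sqnorm q) (sqnorm p).
have pq : sqnorm p - sqnorm q = dot (p - q) (p + q).
  by rewrite /sqnorm dotDr !dotDl -(scaleN1r q) !dotZl (dotC q p); ring.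
rewrite pq normrM -mulrA; apply: ler_pM => //.
  apply: hM; move: rq; rewrite !ler_norml => /andP[r1 r2].
  have : `|sqnorm p - sqnorm q| <= 3 * Z ^+ 2 by rewrite ler_norml; apply/andP;
    split; lra.
  by move=> h; apply/andP; split; lra.
apply: le_trans (dot_bound _ _) _.
have -> : 3 * (`|p - q| * `|p + q|) = 3 * `|p + q| * `|p - q| by ring.
by apply: ler_wpM2r => //; have := ler_normD p q; lra.
Qed.

Section bootstrap.
Variables (R : realType) (a H : R -> R).
Variables (g0 : phase6 R -> R) (g : R -> phase6 R -> R) (sigma W : R
  -> 'rV[R]_3 -> R).
Hypotheses (HH : admissible_profile H) (Ha : scale_factor a).
Hypothesis hs : perturbation_solution a H g0 g sigma W.

Lemma solution_continuous (t : R) (x : 'rV[R]_3) : 0 <= t ->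
  continuous (fun v => g t (x, v)).
Proof.
move=> t0 v; have [[cg _] _] := sol_Cper hs t0.
apply: (@continuous_comp _ _ _ (fun v => (x, v)) (g t)); last exact: cg.
have h1 : ((fun _ : 'rV[R]_3 => x) y @[y --> v]) --> x.
  exact: (@cvg_cst _ x _ (nbhs v) _).
exact: (cvg_pair h1 cvg_id).
Qed.

Lemma solution_support (T : R) : 0 <= T -> exists2 u, 0 <= u &
  forall t (x v : 'rV[R]_3), 0 <= t <= T -> u < `|v| -> g t (x, v) = 0.
Proof.
move=> T0; have [u hu] := sol_support hs T0.
exists `|u| => // t x v tT uv; apply: hu => //.
by apply: le_lt_trans (ler_norm _) _; apply: lt_le_trans uv (norm_le_enorm _).
Qed.

(** The source 4 pi a^2 sigma of the Poisson equation is at most 4 pi w / a. The decay 1 / a is kept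
    in the Hoelder bound, which must be integrated in time; the gradient bound only confines the
    polygons to a compact set. *)
Lemma force_bounds (c s w : R) : 0 <= s -> 0 < c -> 1 + c * s <= a s ->
  (forall x, a s ^+ 3 * `|sigma s x| <= w) ->
  (forall x, `|grad (W s) x| <= pi * w) /\
  (forall x y, `|grad (W s) x - grad (W s) y| <=
     20 * pi * w / (1 + c * s) * Num.sqrt `|x - y|).
Proof.
move=> s0 c0 aL hw.
have L1 : 1 <= 1 + c * s by rewrite lerDl mulr_ge0// ltW.
have a0 : 0 < a s by lra.
have w0 : 0 <= w by apply: le_trans (hw 0); rewrite mulr_ge0// exprn_ge0// ltW.
have p0 : 0 <= pi :> R by exact: pi_ge0.
have lap x : `|laplacian (W s) x| <= 4 * pi * w / a s.
  rewrite (sol_poisson hs x s0) normrM (ger0_norm (_ : 0 <= 4 * pi * a s ^+ 2));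
    last by rewrite !mulr_ge0// ltW.
  rewrite ler_pdivlMr//.
  have -> : 4 * pi * a s ^+ 2 * `|sigma s x| * a s
    = 4 * pi * (a s ^+ 3 * `|sigma s x|) by ring.
  by rewrite ler_wpM2l// mulr_ge0.
split=> [x|x y].
  apply: le_trans (grad_bound (sol_potential hs s0) lap x) _.
  have -> : 4 * pi * w / a s / 4 = pi * w / a s by field; rewrite gt_eqF.
  by rewrite ler_pdivrMr// ler_peMr ?mulr_ge0//; lra.
apply: le_trans (grad_holder (sol_potential hs s0) lap x y) _.
apply: ler_wpM2r; first exact: sqrtr_ge0.
have -> : 5 * (4 * pi * w / a s) = 20 * pi * w / a s by ring.
by apply: ler_wpM2l; [rewrite !mulr_ge0|rewrite lef_pV2 ?posrE//; lra].
Qed.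

Variables (c C M eps R0 LH : R).
Hypotheses (c0 : 0 < c) (C0 : 0 < C) (M0 : 0 < M).
Hypotheses (R01 : 1 <= R0) (LH0 : 0 <= LH).
Hypothesis aL : forall s : R, 0 <= s -> 1 + c * s <= a s.
Hypothesis g0eps : forall z, `|g0 z| <= eps.
Hypothesis g0R0 : forall x v : 'rV[R]_3, R0 < `|v| -> g0 (x, v) = 0.
Hypothesis HR0 : forall v : 'rV[R]_3, R0 < `|v| -> H (sqnorm v) = 0.
Notation S := (growth_weight c C M).
Notation K := (2 * R0 + 2).
Hypothesis hLH : forall p q : 'rV[R]_3,
  `|p| <= 2 * K + 1 -> `|q| <= 2 * K + 1 ->
  `|H (sqnorm p) - H (sqnorm q)| <= LH * `|p - q|.
Notation gam := (20 * pi * Num.sqrt (2 / c) * (2 / C)).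

Let eps0 : 0 <= eps. Proof. exact: le_trans (normr_ge0 _) (g0eps 0). Qed.
Let K4 : 4 <= K. Proof. by have := R01; lra. Qed.

Lemma initial_density_bound x : `|sigma 0 x| <= eps * (2 * K) ^+ 3.
Proof.
have R1 := R01; rewrite (sol_density hs x (lexx 0)).
have := @le_integral3_box R (fun v => g 0 (x, v)) R0 0 0 K 0 eps 0.
rewrite mul0r addr0; apply => //.
- exact: solution_continuous.
- by move=> v; rewrite (sol_init hs); exact: g0R0.
- by lra.
- move=> v; rewrite (sol_init hs) mul0r addr0 subr0.
  case: (leP `|v| K) => [_|Kv]; first by rewrite /= ?mulr1n ?mulr1.
  by rewrite g0R0 ?normr0 /= ?mulr0n ?mulr0//; lra.
Qed.

(** Along polygons f(t, x, w) is close to H(|P w|^2) + g0, and P w is close to w + c with c = P w1 -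
    w1. Replacing P w by w + c costs [LH] times the divergence of shifts, dropping g0 costs [eps],
    and both losses occur only for w within [K] of [w1]. [density_estimate] turns this into a bound
    on sigma. *)
Lemma bootstrap_step (t : R) : 0 < t -> gam * S t <= 2^-1 ->
  (forall s x, 0 <= s <= t -> a s ^+ 3 * `|sigma s x| <= S s) ->
  forall x,
    a t ^+ 3 * `|sigma t x| <= (2 * K) ^+ 3 * (eps + LH * (gam * K * S t)).
Proof.
move=> tp gS hP x; have t0 := ltW tp; have R1 := R01; have K1' := K4;
  have e0' := eps0.
have p0 : 0 <= pi :> R by exact: pi_ge0.
pose B := pi * S t.
have S0 s : 0 < S s by exact: growth_weight_gt0.
have B0 : 0 <= B by rewrite mulr_ge0// ltW.
have fb s (st : 0 <= s <= t) : _ :=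
  @force_bounds c s (S s) (proj1 (andP st)) c0 (aL (proj1 (andP st))) (fun x
    => hP s x st).
have hB s y : 0 <= s <= t -> `|grad (W s) y| <= B.
  move=> st; have [h _] := fb s st; apply: le_trans (h y) _.
  case/andP: st => s0 st; rewrite ler_wpM2l//; exact: growth_weight_homo.
have hF s y z : 0 <= s <= t -> `|grad (W s) y - grad (W s) z| <=
    20 * pi * S s / (1 + c * s) * Num.sqrt `|y - z|.
  by move=> st; have [_ h] := fb s st; exact: h.
have Cf0 : 0 <= 20 * pi :> R by rewrite mulr_ge0.
have a00 : a 0 = 1 by have [_ _ _ a01 _] := Ha.
have at1 := aL t0.
have at0 : 0 < a t by apply: lt_le_trans at1; rewrite ltr_pwDl// mulr_ge0// ltW.
have [u u0 hu] := solution_support t0.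
have tt : 0 <= t <= t by rewrite t0 lexx.
(* The box of radius [Y] contains the momentum support of f(t, x, .), from [R0] and [a t * u], and
   the box of radius [K] about [w1], since |w1| <= |P w1| + t B <= 1 + t B. *)
pose Y := R0 + a t * u + K + 1 + t * B.
have tB : 0 <= t * B by rewrite mulr_ge0.
have au : 0 <= a t * u by rewrite mulr_ge0// ltW.
have Y0 : 0 <= Y by rewrite /Y; lra.
have f0E y w : phase_density a H g 0 y w = H (sqnorm w) + g0 (y, w).
  by rewrite /phase_density a00 invr1 scale1r (sol_init hs).
have ftY (w : 'rV[R]_3) : Y < `|w| -> phase_density a H g t x w = 0.
  rewrite /Y => wY; rewrite /phase_density HR0; last by lra.
  rewrite hu ?addr0// normrZ gtr0_norm ?invr_gt0// mulrC ltr_pdivlMr// mulrC.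
  lra.
have X0 : 0 <= gam * K * S t.
  apply: mulr_ge0; last exact: ltW.
  apply: mulr_ge0; last by lra.
  apply: mulr_ge0; last by rewrite divr_ge0// ltW.
  by apply: mulr_ge0 => //; exact: sqrtr_ge0.
(* The bound is proved up to an arbitrary [e] at fixed [t] and [x]. So [err] may be divided by the
   volume of the time-dependent box, and the number of steps may depend on all of them. *)
apply/ler_addgt0Pr => e e0.
pose err := e / ((2 * K) ^+ 3 + (2 * Y) ^+ 3 + 1).
have den : 0 < (2 * K) ^+ 3 + (2 * Y) ^+ 3 + 1.
  by rewrite ltr_wpDl// addr_ge0// exprn_ge0// mulr_ge0//; lra.
have err0 : 0 < err by rewrite divr_gt0.
have [m hm] := @polygon_transport R a H g W t B Ha HH (sol_C1 hs)
  (sol_vlasov hs) t0 B0 hB x Y err tp Y0 err0.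
pose n := (m + (Num.bound (C * t)).+1)%N.
have mn : (m < n)%N by rewrite /n addnS ltnS leq_addr.
have n0 : (0 < n)%N by exact: leq_ltn_trans mn.
have nR : 0 < n%:R :> R by rewrite ltr0n.
have hsm : C * (t / n%:R) <= 1.
  rewrite mulrA ler_pdivrMr// mul1r.
  have Ct : 0 <= C * t by rewrite mulr_ge0// ltW.
  apply: le_trans (ltW (archi_boundP Ct)) _; rewrite ler_nat /n.
  by rewrite (leq_trans (leqnSn _))// leq_addl.
pose F := fun s => grad (W s).
pose P w := (polygon a F t (t / n%:R) (x, w) n).2.
have div := @polygon_divergence R a F c C M (20 * pi) t n c0 C0 M0 Cf0 t0 n0 aL
  hF hsm gS x.
have [w1 Pw1] := @polygon_reaches_unit_ball R a F c C M (20 * pi) t n c0 C0 M0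
  Cf0 t0 n0 aL hF hsm gS x.
rewrite -/(P w1) in Pw1.
pose k1 := eps + LH * (gam * K * S t) + err.
have key (w : 'rV[R]_3) : `|phase_density a H g t x w - H (sqnorm (w
  + (P w1 - w1)))| <=
    k1 * (`|w - w1| <= K)%R%:R + err * (`|w| <= Y)%R%:R.
  have wc : w + (P w1 - w1) = (w - w1) + P w1 by rewrite addrCA addrC.
  have [wK|wK] := leP `|w - w1| K.
    have wY : `|w| <= Y.
      have [_ h2 _] := @polygon_bounds R a W t B Ha t0 B0 hB x w1 n n n0 (leqnn
        n).
      have := ler_normD (w - w1) w1; rewrite subrK.
      have := ler_normB (P w1) (P w1 - w1); rewrite opprB addrCA subrr addr0.
      by rewrite /Y; rewrite -/F -/(P w1) in h2; lra.
    rewrite wY /= ?mulr1n ?mulr1.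
    have h1 := hm n w mn wY; rewrite /= f0E -/F in h1.
    have K1 : 1 <= K by lra.
    have d1 := div w w1 K K1 wK; rewrite -/(P w) -/(P w1) /= in d1.
    have d2 : gam * K * S t <= K * 2^-1.
      have -> : gam * K * S t = K * (gam * S t) by ring.
      by rewrite ler_wpM2l//; lra.
    have q1 : `|w + (P w1 - w1)| <= K + 1.
      by rewrite wc; apply: le_trans (ler_normD _ _) _; exact: lerD.
    have pq : P w - (w + (P w1 - w1)) = P w - w - (P w1 - w1)
      by rewrite opprD addrA.
    (* |w + c| <= K + 1 and the divergence is at most K / 2, so both arguments of [H] lie in the
       ball where [LH] is a Lipschitz constant. *)
    have q2 : `|P w| <= 2 * K + 1.
      have := ler_normD (P w - (w + (P w1 - w1))) (w + (P w1 - w1)).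
      by rewrite subrK pq; lra.
    have hl := hLH q2 (_ : `|w + (P w1 - w1)| <= 2 * K + 1).
    have {}hl := hl ltac:(lra); rewrite pq in hl.
    have hl2 : LH * `|P w - w - (P w1 - w1)| <= LH * (gam * K * S t)
      by rewrite ler_wpM2l.
    have ge := g0eps ((polygon a F t (t / n%:R) (x, w) n).1, P w).
    rewrite -/(P w) in h1.
    set f := phase_density _ _ _ _ _ _ in h1 *.
    move: h1 hl ge; set A1 := H _; set A2 := g0 _; set A3 := H _ => h1 hl ge.
    have -> : f - A3 = - (A1 + A2 - f) + (A1 - A3) + A2 by ring.
    apply: le_trans (ler_normD _ _) _.
    apply: le_trans (lerD (ler_normD _ _) (lexx _)) _; rewrite normrN /k1; lra.
  (* Far from [w1] the translate vanishes, as |w + c| >= |w - w1| - 1 > R0; it remains to see that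
     f(t, x, w) is at most [err]. *)
  rewrite /= ?mulr0n ?mulr0 add0r (HR0 (_ : R0 < `|w + (P w1 - w1)|));
    last first.
    by rewrite wc; have := ler_normB (w - w1 + P w1) (P w1); rewrite addrK; lra.
  rewrite subr0; have [wY|wY] := leP `|w| Y; last
    by rewrite ftY// normr0 /= ?mulr0n ?mulr0.
  have h1 := hm n w mn wY; rewrite /= f0E -/F -/(P w) in h1.
  have K1 : 1 <= `|w - w1| by lra.
  have d1 := div w w1 _ K1 (lexx _); rewrite -/(P w) -/(P w1) /= in d1.
  have d2 : gam * `|w - w1| * S t <= `|w - w1| * 2^-1.
    have -> : gam * `|w - w1| * S t = `|w - w1| * (gam * S t) by ring.
    by rewrite ler_wpM2l//; lra.
  (* Origin of K = 2 R0 + 2: the polygon map keeps at least half of the distance to [w1], so |P w| >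
     K / 2 - 1 = R0, outside the supports of [H] and of the datum. *)
  have PR : R0 < `|P w|.
    have := ler_normB (P w - P w1) (P w - w - (P w1 - w1)).
    have -> : P w - P w1 - (P w - w - (P w1 - w1)) = w - w1.
      by apply/rowP => i; rewrite !mxE; ring.
    have := ler_normB (P w) (P w1); lra.
  rewrite HR0// g0R0// addr0 sub0r normrN in h1.
  by rewrite /= ?mulr1n ?mulr1.
have := @density_estimate R H HH (a t) u (fun v => g t (x,
  v)) (P w1 - w1) w1 K Y k1 err
  at0 (@solution_continuous t x t0) (fun v uv => hu t x v tt uv) _ Y0 key.
rewrite -(sol_density hs x t0) => /(_ ltac:(lra)) est.
have : a t ^+ 3 * `|sigma t x| <= k1 * (2 * K) ^+ 3 + err * (2 * Y) ^+ 3.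
  rewrite mulrC -ler_pdivlMr ?exprn_gt0// mulrC; exact: est.
move=> /le_trans; apply.
have eE : err * ((2 * K) ^+ 3 + (2 * Y) ^+ 3 + 1) = e
  by rewrite mulfVK// gt_eqF.
rewrite /k1 -eE; set b1 := (2 * K) ^+ 3; set b2 := (2 * Y) ^+ 3;
  set b3 := LH * _.
have -> : b1 * (eps + b3) + err * (b1 + b2 + 1) = (eps + b3 + err) * b1
  + err * b2 + err by ring.
by rewrite lerDl ltW.
Qed.

End bootstrap.

(** * Continuity in time and the continuation argument *)

Lemma sup_norm_le (R : realType) (T : Type) (h : T -> R) (B : R) :
  (forall x, `|h x| <= B) -> (sup_norm h <= B%:E)%E.
Proof. by move=> hB; apply: ge_ereal_sup => _ [x _ <-]; rewrite lee_fin. Qed.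

Lemma le_sup_norm (R : realType) (T : Type) (h : T -> R) (x : T) :
  (`|h x|%:E <= sup_norm h)%E.
Proof. by apply: ereal_sup_ubound; exists x. Qed.

Lemma sup_norm_le_norm1oo (R : realType) (h : phase6 R -> R) :
  (sup_norm h <= norm1oo h)%E.
Proof.
rewrite /norm1oo leeDl//; apply: sume_ge0 => j _.
by apply: le_trans (le_sup_norm _ 0); rewrite lee_fin.
Qed.

Section continuity.
Variables (R : realType) (a H : R -> R).
Variables (g0 : phase6 R -> R) (g : R -> phase6 R -> R) (sigma W : R
  -> 'rV[R]_3 -> R).
Hypothesis Ha : scale_factor a.
Hypothesis hs : perturbation_solution a H g0 g sigma W.

Lemma solution_time_continuous (t e : R) : 0 <= t -> 0 < e ->
  exists2 d, 0 < d & forall s : R, 0 <= s -> `|s - t| < d ->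
    forall z, `|g s z - g t z| <= e.
Proof.
move=> t0 e0; have := sol_continuous_C1per hs t0.
have e0' : (0 < e%:E)%E by rewrite lte_fin.
move=> /(_ _ (open_ereal_lt' e0')); rewrite /fmap /within /=
  => /nbhs_normP[d /= d0 hd].
exists d => // s s0 sd z.
have := hd s; rewrite /= distrC => /(_ sd s0) h.
rewrite -lee_fin; apply: le_trans (ltW h).
apply: le_trans (sup_norm_le_norm1oo _).
exact: (le_sup_norm (fun z => g s z - g t z)).
Qed.

(** The velocity support is bounded by one [u] on [0, t + 1], so uniform closeness of [g] is only
    multiplied by the volume of a fixed box. *)
Lemma density_time_continuous (t e : R) : 0 <= t -> 0 < e ->
  exists2 d, 0 < d & forall s : R, 0 <= s -> `|s - t| < d ->
    forall x, `|sigma s x - sigma t x| <= e.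
Proof.
move=> t0 e0.
have T0 : 0 <= t + 1 by lra.
have [u u0 hu] := solution_support hs T0.
have k0 : 0 < (2 * u) ^+ 3 + 1 by rewrite ltr_wpDl// exprn_ge0// mulr_ge0.
have [d d0 hd] := solution_time_continuous t0 (divr_gt0 e0 k0).
exists (Num.min d 1) => [|s s0]; first by rewrite lt_min d0 ltr01.
rewrite lt_min => /andP[sd s1] x.
have st : 0 <= s <= t + 1.
  by rewrite s0; move: s1; rewrite ltr_norml => /andP[_ s1]; lra.
have tt : 0 <= t <= t + 1 by rewrite t0 lerDl ler01.
have cs := @solution_continuous _ _ _ _ _ _ _ hs s x s0.
have ct := @solution_continuous _ _ _ _ _ _ _ hs t x t0.
pose D v := g s (x, v) - g t (x, v).
have cD : continuous D by move=> v; exact: (cvgB (cs v) (ct v)).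
have hD v : u < `|v| -> D v = 0 by move=> uv; rewrite /D !hu// subr0.
have E : integral3 setT (fun v => g s (x, v)) = integral3 setT (fun v
  => g t (x, v)) + integral3 setT D.
  rewrite -(integral3D ct (fun v uv => hu t x v tt uv) cD hD).
  by congr integral3; apply/funext => v; rewrite /D subrKC.
rewrite !(sol_density hs)// E addrC addrA addNr add0r.
set k := e / _ in hd.
have := @le_integral3_box R D u 0 0 u 0 k 0 cD hD u0 (lexx 0).
rewrite mul0r addr0 => est; apply: le_trans (est _) _.
  move=> v; rewrite mul0r addr0 subr0.
  case: (leP `|v| u) => [_|uv] /=; last by rewrite hD// normr0 mulr0.
  by rewrite mulr1; exact: hd.
rewrite /k mulrAC ler_pdivrMr// ler_pM2l//; lra.
Qed.

(** The change of a^3 multiplies |sigma(t, x)|, so uniformity in [x] holds where that is at most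
    [beta]. Both a global bound at a fixed time and a single point are covered. *)
Lemma scaled_density_time_continuous (t beta e : R) : 0 <= t -> 0 < e ->
  exists2 d, 0 < d & forall s : R, 0 <= s -> `|s - t| < d ->
    forall x, `|sigma t x| <= beta ->
      `|a s ^+ 3 * `|sigma s x| - a t ^+ 3 * `|sigma t x| | <= e.
Proof.
move=> t0 e0.
have [c [A [c0 aL bA aA _]]] := scale_factor_bounds Ha.
have ad (s : R) : 0 <= s -> time_derivable a s by move=> s0;
  have [_ /(_ s s0)[]] := Ha.
pose B := `|a t| + 1.
have B1 : 1 <= B by rewrite lerDr.
have B3 : 0 < B ^+ 3 by rewrite exprn_gt0//; lra.
pose e1 := e / (2 * B ^+ 3).
have e10 : 0 < e1 by rewrite divr_gt0// mulr_gt0.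
have [d1 d10 hd1] := density_time_continuous t0 e10.
have b0 : 0 < `|beta| + 1 by rewrite ltr_wpDl.
pose k := 3 * B ^+ 2 * (`|beta| + 1).
have Bp : 0 < B by lra.
have k0 : 0 < k by apply: mulr_gt0 => //; apply: mulr_gt0 => //;
  exact: exprn_gt0.
pose e2 := Num.min 1 (e / (2 * k)).
have e20 : 0 < e2 by rewrite lt_min ltr01 divr_gt0// mulr_gt0.
have [d2 d20 hd2] := time_derivable_cont t0 (ad t t0) e20.
exists (Num.min d1 d2) => [|s s0]; first by rewrite lt_min d10.
rewrite lt_min => /andP[sd1 sd2] x xb.
have h1 := hd1 s s0 sd1 x; have h2 := hd2 s s0 sd2.
rewrite lt_min in h2; case/andP: h2 => h2 h3.
have at0 : 0 < a t by have [] := Ha => + _ _ _ _; exact.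
have as0 : 0 < a s by have [] := Ha => + _ _ _ _; exact.
have aB : a s <= B.
  by rewrite /B (gtr0_norm at0); move: h2; rewrite ltr_norml => /andP[_ h2];
    lra.
have aB' : a t <= B by rewrite /B (gtr0_norm at0) lerDl.
have -> : a s ^+ 3 * `|sigma s x| - a t ^+ 3 * `|sigma t x| =
  a s ^+ 3 * (`|sigma s x| - `|sigma t x|) +
  (a s - a t) * (a s ^+ 2 + a s * a t + a t ^+ 2) * `|sigma t x| by ring.
apply: le_trans (ler_normD _ _) _.
have -> : e = e / 2 + e / 2 by field.
apply: lerD.
  have p0 : 0 <= a s ^+ 3 by rewrite exprn_ge0// ltW.
  have p1 : a s ^+ 3 <= B ^+ 3 by rewrite ler_pXn2r// nnegrE ltW.
  have p2 : `| `|sigma s x| - `|sigma t x| | <= e1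
    by exact: le_trans (ler_dist_dist _ _) h1.
  rewrite normrM (ger0_norm p0); apply: le_trans (ler_pM p0 (normr_ge0 _) p1
    p2) _.
  by rewrite /e1 (_ : B ^+ 3 * _ = e / 2)//; field; rewrite gt_eqF.
have q0 : 0 <= a s ^+ 2 + a s * a t + a t ^+ 2.
  by rewrite !addr_ge0 ?exprn_ge0 ?mulr_ge0 ?ltW.
rewrite !normrM normr_id (ger0_norm q0).
have h3' : `|a s - a t| * (a s ^+ 2 + a s * a t + a t ^+ 2) * `|sigma t x|
  <= e / (2 * k) * (3 * B ^+ 2) * (`|beta| + 1).
  apply: ler_pM => //; first by rewrite mulr_ge0.
    apply: ler_pM => //; first exact: ltW.
    have -> : 3 * B ^+ 2 = B ^+ 2 + B * B + B ^+ 2 by ring.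
    by apply: lerD; [apply: lerD|]; rewrite ?expr2; apply: ler_pM => //;
      exact: ltW.
  by apply: le_trans xb _; apply: le_trans (ler_norm _) _; rewrite lerDl.
apply: le_trans h3' _.
have -> : e / (2 * k) * (3 * B ^+ 2) * (`|beta| + 1) = e / (2 * k) * k
  by rewrite /k; ring.
have -> : e / (2 * k) * k = e / 2 by field; rewrite gt_eqF.
by [].
Qed.

End continuity.

(** At the infimum [ts] of the times where the bound fails, it still holds by continuity from the
    left, so [step] improves it to [th * S ts]; the gain forbids failure shortly afterwards. Left
    limits need continuity at each [x] only. Continuity uniform in [x] is needed past [ts], and its
    hypothesis, a bound at [ts], is available by then. *)
Lemma continuation_principle (R : realType) (T : Type) (phi : R -> T -> R)
    (S : R -> R) (th : R) :
  th < 1 -> (forall t, 0 < S t) ->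
  (forall s t : R, 0 <= s -> s <= t -> S s <= S t) ->
  (forall t x, 0 <= t -> 0 <= phi t x) ->
  (forall x, phi 0 x <= th * S 0) ->
  (forall t : R, 0 < t -> (forall s x, 0 <= s <= t -> phi s x <= S s) ->
     forall x, phi t x <= th * S t) ->
  (forall t e : R, 0 <= t -> 0 < e -> (exists B, forall x, phi t x <= B) ->
     exists2 d, 0 < d & forall s : R, 0 <= s -> `|s - t| < d ->
       forall x, `|phi s x - phi t x| <= e) ->
  (forall x (t e : R), 0 <= t -> 0 < e ->
     exists2 d, 0 < d & forall s : R, 0 <= s -> `|s - t| < d ->
       `|phi s x - phi t x| <= e) ->
  forall t x, 0 <= t -> phi t x <= S t.
Proof.
move=> th1 S0 Shomo phi0 init step ucont pcont t1 x1 t10.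
rewrite leNgt; apply/negP => bad1.
pose Bad := [set t : R | 0 <= t /\ exists x, S t < phi t x].
have Bad1 : Bad t1 by split => //; exists x1.
have infB : has_inf Bad by split; [exists t1|exists 0 => t []].
pose ts := inf Bad.
have ts0 : 0 <= ts by apply: lb_le_inf; [exists t1|move=> t []].
have good s x : 0 <= s -> s < ts -> phi s x <= S s.
  move=> s0 sts; rewrite leNgt; apply/negP => sb.
  have : ts <= s by apply: ge_inf; [exact: infB.2|split => //; exists x].
  by rewrite leNgt sts.
have good_ts x : phi ts x <= th * S ts.
  have [ts00|tsp] := eqVneq ts 0; first by rewrite ts00.
  have tsp' : 0 < ts by rewrite lt_neqAle eq_sym tsp.
  apply: step => // s y /andP[s0]; rewrite le_eqVlt => /predU1P[->|];
    last exact: good.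
  apply/ler_addgt0Pr => e e0.
  have [d d0 hd] := pcont y ts e ts0 e0.
  pose s' := Num.max 0 (ts - d / 2).
  have s'0 : 0 <= s' by rewrite le_max lexx.
  have s'ts : s' < ts by rewrite gt_max tsp'; lra.
  have s'd : ts - d / 2 <= s' by rewrite le_max lexx orbT.
  have := hd s' s'0 _; rewrite ltr0_norm ?subr_lt0// => /(_ ltac:(lra)).
  have := good s' y s'0 s'ts; have := Shomo s' ts s'0 (ltW s'ts).
  by rewrite ler_norml => ? ? /andP[]; lra.
(* [e] is the whole margin: phi(t) <= th S(ts) + e = S(ts) <= S(t) for t just after [ts]. *)
pose e := (1 - th) * S ts.
have e0 : 0 < e by rewrite mulr_gt0// subr_gt0.
have [d d0 hd] := ucont ts e ts0 e0 (ex_intro _ (th * S ts) good_ts).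
have [t [t0 [x xb]] ttd] := inf_adherent d0 infB.
have tts : ts <= t by apply: ge_inf; [exact: infB.2|split => //; exists x].
have := hd t t0 _ x; rewrite ger0_norm ?subr_ge0//
  => /(_ ltac:(rewrite -/ts in ttd; lra)).
have := good_ts x; have := Shomo ts t ts0 tts.
by rewrite /e ler_norml => ? ? /andP[]; lra.
Qed.

(** * Density in the original variables and choice of the constants *)

Lemma density_contrastE (R : realType) (a H : R -> R) (g0 : phase6 R -> R)
    (g : R -> phase6 R -> R) (sigma W : R -> 'rV[R]_3 -> R)
    (t : R) (x : 'rV[R]_3) :
  admissible_profile H -> perturbation_solution a H g0 g sigma W ->
  0 <= t -> 0 < a t ->
  vp_rho a H g t x = a t ^- 3 + sigma t ((a t)^-1 *: x).
Proof.
move=> HH hs t0 at0.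
pose y : 'rV[R]_3 := (time_derive a t / a t) *: x.
have [u u0 hu] := solution_support hs t0.
have tt : 0 <= t <= t by rewrite t0 lexx.
have cg := @solution_continuous _ _ _ _ _ _ _ hs t ((a t)^-1 *: x) t0.
have sg (v : 'rV[R]_3) : u < `|v| -> g t ((a t)^-1 *: x, v) = 0 by exact: hu.
have [u1 hu1] := profile_affine_support HH (- (a t *: y)) at0.
have cH := @continuous_profile_affine _ _ HH (a t) (- (a t *: y)).
have cg' : continuous (fun v : 'rV[R]_3 => g t ((a t)^-1 *: x, 1 *: v + (- y))).
  move=> v; apply: (@continuous_comp _ _ _ (fun v : 'rV[R]_3
    => 1 *: v + (- y)) (fun v => g t ((a t)^-1 *: x, v))); last exact: cg.
  exact: (cvgD (@scaler_continuous _ _ 1 v) (cvg_cst (- y))).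
have sg' (v : 'rV[R]_3) : u + `|y| < `|v| -> g t ((a t)^-1 *: x,
  1 *: v + (- y)) = 0.
  move=> uv; apply: sg; rewrite scale1r.
  have := ler_normD (v - y) y; rewrite subrK; lra.
(* With [y] the background velocity at [x], the background is the profile at a v - a y, of mass
   a^-3, and the perturbation is a translate by [y]; the two are integrated separately. *)
rewrite -(integral_profile_affine HH (- (a t *: y)) at0) (sol_density hs _ t0).
have := integral3_affine (- y) (ltr01 : 0 < 1 :> R) cg sg.
rewrite expr1n invr1 mul1r => <-.
rewrite -(integral3D cH hu1 cg' sg'); congr integral3; apply/funext => v.
rewrite /vp_f /f_bg /= scale1r -/y; congr (H _ + _).
by rewrite -scalerBr sqnormZ.
Qed.

Theorem theorem1p1 (R : realType) (H a : R -> R) (d0 u0 : R)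
    (HH : admissible_profile H) (Ha : scale_factor a)
    (d0_gt0 : 0 < d0) (u0_gt0 : 0 < u0) :
  forall eps1 : R, 0 < eps1 ->
  exists2 eps0 : R, 0 < eps0 &
  forall (g0 : phase6 R -> R) (g : R -> phase6 R -> R)
         (sigma W : R -> space3 R -> R),
    admissible_data H d0 u0 g0 ->
    (sup_norm g0 < eps0%:E)%E ->
    perturbation_solution a H g0 g sigma W ->
    (forall t : R, 0 <= t -> (sup_norm (sigma t) < (a t ^- 3 * eps1)%:E)%E) /\
    (forall delta : R -> space3 R -> R,
       (forall (t : R) (x : space3 R), 0 <= t ->
          vp_rho a H g t x = rho_bg a t * (1 + delta t x)) ->
       forall t : R, 0 <= t -> (sup_norm (delta t) < eps1%:E)%E).
Proof.
move=> eps1 eps10.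
have [c [A [c0 aL _ _ _]]] := scale_factor_bounds Ha.
have [Ss Ss0 hSs] := profile_support HH.
(* One radius for the datum and for H(|v|^2); the summand 1 gives |v|^2 >= |v| > [Ss]. *)
pose R0 : R := 1 + u0 + Ss.
have R01 : 1 <= R0 by rewrite /R0; lra.
have HR0 (v : 'rV[R]_3) : R0 < `|v| -> H (sqnorm v) = 0.
  move=> Rv; apply: hSs; apply: lt_le_trans (norm2_le_sqnorm v).
  by move: Rv; rewrite /R0; set q := `|v| => Rv; nra.
pose K := 2 * R0 + 2.
have Z0 : 0 <= 2 * K + 1 by rewrite /K; lra.
have [LH LH0 hLH] := profile_sqnorm_lipschitz HH Z0.
pose G : R := 20 * pi * Num.sqrt (2 / c).
have G0 : 0 <= G by rewrite !mulr_ge0 ?pi_ge0 ?sqrtr_ge0.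
pose k3 : R := (2 * K) ^+ 3.
have k30 : 0 < k3 by rewrite exprn_gt0// /K; lra.
pose X : R := k3 * LH * K.
have X0 : 0 <= X by rewrite /X !mulr_ge0 ?(ltW k30)// /K; lra.
(* [C] is tuned so that gam = 2 G / C satisfies gam (2 + 4 X) <= 1. This contains both gam <= 1/2,
   for the divergence of polygons, and gam X <= 1/4, for the bootstrap. *)
pose C : R := (G + 1) * (4 + 8 * X).
have C0 : 0 < C by rewrite mulr_gt0//; lra.
have gamE : G * (2 / C) * (2 + 4 * X) <= 1.
  have -> : G * (2 / C) * (2 + 4 * X) = G / (G + 1).
    by rewrite /C; field; rewrite !gt_eqF//; lra.
  by rewrite ler_pdivrMr ?mul1r; lra.
set gam := G * (2 / C) in gamE.
have gam0 : 0 <= gam by rewrite mulr_ge0// divr_ge0// ltW.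
pose Ex := expR (C * (2 / c)).
have Ex0 : 0 < Ex by exact: expR_gt0.
(* The ceiling of the weight: 1 turns gam <= 1/2 into gam S <= 1/2, and [eps1 / 2] gives the
   conclusion. *)
pose eta := Num.min 1 (eps1 / 2).
have eta0 : 0 < eta by rewrite lt_min ltr01 divr_gt0.
have eta1 : eta <= 1 by rewrite ge_min lexx.
have eta2 : eta <= eps1 / 2 by rewrite ge_min lexx orbT.
(* [Ex] bounds the exponential in the weight at all times, so the weight never exceeds [eta]. The
   choice of [eps0] below lets the data use half of the initial weight [M]. *)
pose M := eta / Ex.
have M0 : 0 < M by rewrite divr_gt0.
pose eps0 := M / (2 * k3).
have eps00 : 0 < eps0 by rewrite divr_gt0// mulr_gt0.
have epsM : k3 * eps0 = M / 2 by rewrite /eps0; field; rewrite gt_eqF.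
exists eps0 => // g0 g sigma W hdata hsmall hs.
pose S := growth_weight c C M.
have S0 s : 0 < S s by exact: growth_weight_gt0.
have Seta s : S s <= eta.
  have -> : eta = M * Ex by rewrite /M divfK// gt_eqF.
  exact: growth_weight_le.
have S00 : S 0 = M.
  by rewrite /S /growth_weight mulr0 addr0 sqrtr1 invr1 subrr !mulr0 expR0
    mulr1.
have Shomo s t : 0 <= s -> s <= t -> S s <= S t by exact: growth_weight_homo.
have g0eps z : `|g0 z| <= eps0.
  by rewrite -lee_fin; apply: le_trans (ltW hsmall); exact: le_sup_norm.
have g0R0 (x v : 'rV[R]_3) : R0 < `|v| -> g0 (x, v) = 0.
  have [_ _ _ _ h] := hdata.
  move=> Rv; apply: h; apply: le_trans (norm_le_enorm v).
  by move: Rv; rewrite /R0; lra.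
have a0 (t : R) : 0 <= t -> 0 < a t by have [h _ _ _ _] := Ha; exact: h.
have a00 : a 0 = 1 by have [_ _ _ h _] := Ha.
have main : forall (t : R) x, 0 <= t -> a t ^+ 3 * `|sigma t x| <= S t.
  (* 3/4 is the sum of 1/2 from the data and 1/4 from the divergence of polygons. *)
  apply: (@continuation_principle R _ (fun t x
    => a t ^+ 3 * `|sigma t x|) S (3 / 4)) => //.
  - by rewrite ltr_pdivrMr//; lra.
  - by move=> t x t0; rewrite mulr_ge0// exprn_ge0// ltW// a0.
  - move=> x; rewrite a00 expr1n mul1r S00.
    have := initial_density_bound hs R01 g0eps g0R0 x.
    rewrite -/K -/k3 mulrC epsM; lra.
  - move=> t t0 hP x.
    have gS : gam * S t <= 2^-1.
      have S1 : S t <= 1 by apply: le_trans eta1.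
      have g2 : gam <= 2^-1.
        have : 0 <= gam * X by exact: mulr_ge0.
        by lra.
      by apply: le_trans g2; rewrite ler_piMr.
    have := bootstrap_step HH Ha hs c0 C0 M0 R01 LH0 aL g0eps g0R0 HR0 hLH t0
      gS hP x.
    rewrite -/K -/k3 -/G -/gam -/S => h; apply: le_trans h _.
    have -> : k3 * (eps0 + LH * (gam * K * S t)) = k3 * eps0 + gam * X * S t
      by rewrite /X; ring.
    rewrite epsM; have MS : M <= S t by rewrite -S00; apply: Shomo => //;
      exact: ltW.
    have : gam * X * S t <= 4^-1 * S t.
      by apply: ler_wpM2r; [exact: ltW|lra].
    lra.
  - move=> t e t0 e0 [B hB].
    have [r r0 hr] := scaled_density_time_continuous Ha hs (B / a t ^+ 3) t0 e0.
    exists r => // s s0 sr x; apply: hr => //.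
    by rewrite ler_pdivlMr ?exprn_gt0 ?a0// mulrC.
  - move=> x t e t0 e0.
    have [r r0 hr] := scaled_density_time_continuous Ha hs (`|sigma t x|) t0 e0.
    by exists r => // s s0 sr; exact: hr.
(* A pointwise strict bound would become weak under the supremum; the factor 1/2 keeps the norms
   strictly below [eps1]. *)
have eps12 : eps1 / 2 < eps1 by lra.
have mainE (t : R) x : 0 <= t -> a t ^+ 3 * `|sigma t x| <= eps1 / 2.
  by move=> t0; apply: le_trans (main t x t0) (le_trans (Seta t) eta2).
split=> [t t0|delta hdelta t t0].
  have a3 : 0 < a t ^+ 3 by rewrite exprn_gt0// a0.
  apply: (@le_lt_trans _ _ (a t ^- 3 * (eps1 / 2))%:E); last first.
    by rewrite lte_fin ltr_pM2l ?invr_gt0.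
  apply: sup_norm_le => x.
  by rewrite mulrC ler_pdivlMr// mulrC mainE.
apply: (@le_lt_trans _ _ (eps1 / 2)%:E); last by rewrite lte_fin.
apply: sup_norm_le => x.
have a3 : a t ^+ 3 != 0 by rewrite expf_neq0// gt_eqF// a0.
have := hdelta t x t0; rewrite (density_contrastE _ HH hs t0 (a0 t t0)) /rho_bg
  mulrDr mulr1.
move=> /addrI h.
have -> : delta t x = a t ^+ 3 * sigma t ((a t)^-1 *: x) by rewrite h mulVKf.
by rewrite normrM (ger0_norm (exprn_ge0 3 (ltW (a0 t t0)))) mainE.
Qed.
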